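(* Let $c:E^1\to G$ be a labelling of a directed graph $E$ by a discrete group $G$, and let $\delta$ be the corresponding coaction of $G$ on $C^*(E)$. Then $$C^*(E)^{\delta}\cong P_{E^0\times\{1_G\}}\,C^*(E\times_c G)\,P_{E^0\times\{1_G\}}.$$
   Context: A directed graph $E=(E^0,E^1,s,r)$ consists of a vertex set $E^0$, an edge set $E^1$, and source and range maps $s,r:E^1\to E^0$. A Cuntz-Krieger $E$-family is a set $\{P_v,S_e:v\in E^0,e\in E^1\}$ of Hilbert space operators with the $P_v$ mutually orthogonal projections and the $S_e$ partial isometries with mutually orthogonal ranges such that (CK1) $S_e^*S_e=P_{r(e)}$ for all $e$; (CK2) $S_eS_e^*\le P_{s(e)}$ for all $e$; (CK3) $P_v=\sum_{e\in s^{-1}(v)}S_eS_e^*$ whenever $0<|s^{-1}(v)|<\infty$. $C^*(E)$ is the universal $C^*$-algebra generated by a Cuntz-Krieger $E$-family. For $X\subseteq E^0$, the sum $\sum_{v\in X}P_v$ converges strictly to a projection $P_X$ in the multiplier algebra $M(C^*(E))$; the same notation is used for other graphs. $1_G$ is the identity of $G$, $C^*(G)$ is the full group $C^*$-algebra, and $s\in G$ also denotes its canonical image in $C^*(G)$. A labelling of $E$ by $G$ is a function $c:E^1\to G$. The skew product $E\times_cG$ is the directed graph with vertex set $E^0\times G$, edge set $E^1\times G$, and $s(e,s)=(s(e),c(e)s)$, $r(e,s)=(r(e),s)$. The coaction corresponding to $c$ is the (normal) coaction $\delta:C^*(E)\to C^*(E)\otimes C^*(G)$ determined by $\delta(S_e)=S_e\otimes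 c(e)$ and $\delta(P_v)=P_v\otimes 1_G$ for $e\in E^1$, $v\in E^0$ (it is a known result that it exists; $C^*(E)$ is nuclear, so the tensor product has a unique $C^*$-norm). The fixed point algebra is $C^*(E)^\delta=\{a\in C^*(E):\delta(a)=a\otimes 1_G\}$. *)

(* Defs.v *)
From HB Require Import structures.
From mathcomp Require Import all_boot all_order all_algebra finmap.
From mathcomp Require Import all_classical all_reals all_analysis.
From mathcomp Require Import complex.
From mathcomp.analysis.showcase Require summability.

Set Implicit Arguments.
Unset Strict Implicit.
Unset Printing Implicit Defensive.

Import Order.TTheory GRing.Theory Num.Theory.
Import numFieldNormedType.Exports.

Local Open Scope classical_set_scope.
Local Open Scope ring_scope.
Local Open Scope complex_scope.

(* No unit is assumed. The norm takes values in R[i], as in every normed module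
   over R[i]. *)
HB.mixin Record isCStar (R : realType) A
    of CompleteNormedModule R[i] A := {
  cmul : A -> A -> A;
  star : A -> A;
  cmulA : associative cmul;
  cmulDl : left_distributive cmul +%R;
  cmulDr : right_distributive cmul +%R;
  scaler_cmull : forall (a : R[i]) x y, cmul (a *: x) y = a *: cmul x y;
  scaler_cmulr : forall (a : R[i]) x y, cmul x (a *: y) = a *: cmul x y;
  starK : involutive star;
  starD : {morph star : x y / x + y};
  starZ : forall (a : R[i]) x, star (a *: x) = Num.conj a *: star x;
  starM : forall x y, star (cmul x y) = cmul (star y) (star x);
  normr_cmul_le : forall x y, `|cmul x y| <= `|x| * `|y|;
  normr_starM : forall x, `|cmul (star x) x| = `|x| ^+ 2
}.

#[short(type="cstarType")]
HB.structure Definition CStar (R : realType) :=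
  {A of isCStar R A & CompleteNormedModule R[i] A}.

Declare Scope cstar_scope.
Delimit Scope cstar_scope with cstar.
Notation "x ** y" := (cmul x y)
  (at level 40, left associativity) : cstar_scope.
Local Open Scope cstar_scope.

Definition cstar_le (R : realType) (A : cstarType R) (x y : A) : Prop :=
  exists z : A, y - x = star z ** z.

Definition projection (R : realType) (A : cstarType R) (p : A) : Prop :=
  star p = p /\ p ** p = p.

Definition partial_isometry (R : realType) (A : cstarType R) (s : A) : Prop :=
  s ** star s ** s = s.

Record star_hom (R : realType) (A B : cstarType R) (f : A -> B) : Prop := {
  star_hom_linear : linear f;
  star_hom_mul : {morph f : x y / x ** y};
  star_hom_star : {morph f : x / star x} }.

Record cstar_subalgebra (R : realType) (A : cstarType R) (D : set A) : Prop := {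
  subalgebra_closed : closed D;
  subalgebra_0 : D 0;
  subalgebra_linear : forall (a : R[i]) x y, D x -> D y -> D (a *: x + y);
  subalgebra_mul : forall x y, D x -> D y -> D (x ** y);
  subalgebra_star : forall x, D x -> D (star x) }.

Definition generates (R : realType) (A : cstarType R) (X : set A) : Prop :=
  forall D : set A, cstar_subalgebra D -> X `<=` D -> D = setT.

(* *-isomorphism between C*-subalgebras X of A and Y of B; the values of f
   outside X are irrelevant. *)
Definition star_isomorphic (R : realType) (A B : cstarType R)
    (X : set A) (Y : set B) : Prop :=
  exists f : A -> B,
    [/\ set_bij X Y f,
        forall (a : R[i]) x y, X x -> X y -> f (a *: x + y) = a *: f x + f y,
        forall x y, X x -> X y -> f (x ** y) = f x ** f y &
        forall x, X x -> f (star x) = star (f x)].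

(* Double centralizers: for m in M(B), mulL m b = m b and mulR m b = b m.
   Linearity and boundedness of both maps follow from the single axiom. *)
Record multiplier (R : realType) (B : cstarType R) := Multiplier {
  mulL : B -> B;
  mulR : B -> B;
  mulRL : forall a b, mulR a ** b = a ** mulL b }.

Definition one_multiplier (R : realType) (B : cstarType R) : multiplier B :=
  @Multiplier R B id id (fun=> fun=> erefl).

(* The net of finite partial sums of (q v) for v in X converges strictly to m. *)
Definition strictly_sums_to (R : realType) (B : cstarType R) (V : choiceType)
    (q : V -> B) (X : set V) (m : multiplier B) : Prop :=
  let s := fun F : {fset V} => \sum_(v <- F | v \in X) q v in
  forall b : B,
    (s F ** b @[F --> summability.totally] --> mulL m b) /\
    (b ** s F @[F --> summability.totally] --> mulR m b).

(* Strict sum of (q v) for v in X; the unit is a junk value for the case of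
   divergence. *)
Definition strict_sum (R : realType) (B : cstarType R) (V : choiceType)
    (q : V -> B) (X : set V) : multiplier B :=
  if pselect (exists m, strictly_sums_to q X m) is left h
  then sval (cid h) else one_multiplier B.

(* The corner m B m, inside B: m (b m) = mulL m (mulR m b). *)
Definition corner (R : realType) (B : cstarType R) (m : multiplier B) : set B :=
  [set mulL m (mulR m b) | b in setT].

(* As every type carries a choiceType structure classically, the choiceType
   requirement is no restriction. *)
Record digraph := Digraph {
  vertex : choiceType;
  edge : choiceType;
  source : edge -> vertex;
  range : edge -> vertex }.

Record cuntz_krieger (R : realType) (E : digraph) (A : cstarType R)
    (P : vertex E -> A) (S : edge E -> A) : Prop := {
  ck_projection : forall v, projection (P v);
  ck_vertex_orthogonal : forall v w, v <> w -> P v ** P w = 0;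
  ck_partial_isometry : forall e, partial_isometry (S e);
  ck_range_orthogonal : forall e f, e <> f ->
    (S e ** star (S e)) ** (S f ** star (S f)) = 0;
  ck1 : forall e, star (S e) ** S e = P (range e);
  ck2 : forall e, cstar_le (S e ** star (S e)) (P (source e));
  ck3 : forall v, let out := [set e | source e = v] in
    out !=set0 -> finite_set out ->
    P v = \sum_(e \in out) S e ** star (S e) }.

(* A with the family (P, S) is a model of C*(E), which its universal property
   determines up to a unique isomorphism; likewise for C*(G) below. *)
Record graph_cstar_algebra (R : realType) (E : digraph) (A : cstarType R)
    (P : vertex E -> A) (S : edge E -> A) : Prop := {
  graph_family : cuntz_krieger P S;
  graph_generates : generates ([set P v | v in setT] `|` [set S e | e in setT]);
  graph_universal : forall (B : cstarType R)
      (Q : vertex E -> B) (W : edge E -> B), cuntz_krieger Q W ->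
    exists f : A -> B,
      [/\ star_hom f, forall v, f (P v) = Q v & forall e, f (S e) = W e] }.

Definition skew_product (E : digraph) (G : groupType) (c : edge E -> G) :=
  @Digraph (vertex E * G)%type (edge E * G)%type
    (fun x => (source x.1, (c x.1 * x.2)%g))
    (fun x => (range x.1, x.2)).

Record unitary_rep (R : realType) (G : groupType) (C : cstarType R)
    (u : G -> C) : Prop := {
  unitary_rep1 : forall x, u 1%g ** x = x /\ x ** u 1%g = x;
  unitary_repM : forall s t, u (s * t)%g = u s ** u t;
  unitary_rep_unitary : forall s,
    star (u s) ** u s = u 1%g /\ u s ** star (u s) = u 1%g }.

Record group_cstar_algebra (R : realType) (G : groupType) (C : cstarType R)
    (u : G -> C) : Prop := {
  group_rep : unitary_rep u;
  group_generates : generates [set u s | s in setT];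
  group_universal : forall (D : cstarType R) (w : G -> D), unitary_rep w ->
    exists f : C -> D, star_hom f /\ forall s, f (u s) = w s }.

(* t corresponds to a *-homomorphism from the algebraic tensor product of A
   and C to T. *)
Record star_bilinear (R : realType) (A C T : cstarType R)
    (t : A -> C -> T) : Prop := {
  star_bilinear_l : forall c, linear (t^~ c);
  star_bilinear_r : forall a, linear (t a);
  star_bilinear_mul : forall a c a' c',
    t a c ** t a' c' = t (a ** a') (c ** c');
  star_bilinear_star : forall a c, star (t a c) = t (star a) (star c) }.

(* T, with elementary tensors (t a c), is the completion of the algebraic
   tensor product in its largest C*-norm, expressed by its universal property.
   When A or C is nuclear this is the only C*-norm. *)
Record cstar_tensor (R : realType) (A C T : cstarType R)
    (t : A -> C -> T) : Prop := {
  tensor_bilinear : star_bilinear t;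
  tensor_generates : generates [set t a c | a in setT & c in setT];
  tensor_universal : forall (D : cstarType R) (w : A -> C -> D),
    star_bilinear w ->
    exists f : T -> D, star_hom f /\ forall a c, f (t a c) = w a c }.

(* delta is the coaction on C*(E) = (A, P, S) corresponding to c; the
   coaction identity, injectivity and normality follow from these values on the
   generators. *)
Record labelling_coaction (R : realType) (E : digraph) (G : groupType)
    (c : edge E -> G) (A C T : cstarType R)
    (P : vertex E -> A) (S : edge E -> A) (u : G -> C) (t : A -> C -> T)
    (delta : A -> T) : Prop := {
  coaction_hom : star_hom delta;
  coaction_edge : forall e, delta (S e) = t (S e) (u (c e));
  coaction_vertex : forall v, delta (P v) = t (P v) (u 1%g) }.

Definition fixed_points (R : realType) (G : groupType) (A C T : cstarType R)
    (u : G -> C) (t : A -> C -> T) (delta : A -> T) : set A :=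
  [set a | delta a = t a (u 1%g)].

(* Main.v *)
Require Import Defs.
From HB Require Import structures.
From mathcomp Require Import all_boot all_order all_algebra finmap.
From mathcomp Require Import all_classical all_reals all_analysis.
From mathcomp Require Import complex ring lra.
From mathcomp.analysis.showcase Require summability.

(** Write B for C*(E x_c G), and call E^0 x {s} the level s of the skew product,
    so that the edge (e, s) leads from the level c(e) s to the level s.

    Intuitively A = C*(E) is graded by G with S_e of degree c(e), the fixed
    points of delta are the part of degree 1, and an element of degree g acts in
    the multiplier algebra of B by moving each level s to the level g s.
    Compressing an element of degree 1 to the level 1 is multiplicative, and this
    compression is the isomorphism.

    Two homomorphisms into C*-algebras of operators on square-summable families
    indexed by G make this precise.  The first, phi, represents A with entries in
    B: S_e has the entries W (e, s) at the positions (c(e) s, s)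
    (amplified_family).  The second, psi, represents B with entries in A:
    W (e, s) has the single entry S_e at that position (matrix_unit_family).  For
    a of degree g with entries m s the element m s is mapped back by psi to the
    single entry a, and as homomorphisms are contractive, |m s| = |a|.  The
    relation homogeneous collects these facts; it holds for the generators and is
    stable under products and adjoints, so homogeneous elements span a dense
    subspace of A and their entries span a dense subspace of B.

    Hence the pairs (a, m 1) with a of degree 1 form the graph of an isometric
    *-homomorphism, and the closure of this graph is an isomorphism between the
    closures of its projections (isometric_graph_isomorphic).  That the second
    closure is the corner follows from the convergence of the sums of vertex
    projections to the identity (corner_strict_sum, corner_dense).  That the
    first is the fixed point algebra needs a contraction which keeps the degree 1
    and kills the other degrees.  It comes from a third homomorphism, defined on
    the tensor product, which sends a (x) g to a times the translation by g
    (regular_representation): if delta(a) = a (x) 1, then the entry at (1, 1) of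
    the image of delta(a - z) is the difference of a and the part of degree 1 of
    z (fixed_points_dense).

    The C*-algebras receiving phi, psi and the third homomorphism are algebras of
    adjointable operators on the Hilbert module of square-summable families.  The
    Cauchy-Schwarz inequality in this module rests on the positivity of x* x
    (pos_starM), obtained from square roots of 1 - x for |x| <= 1
    (iterated_square_root).  The same square roots show that *-homomorphisms are
    contractive (star_hom_le). *)

Set Implicit Arguments.
Unset Strict Implicit.
Unset Printing Implicit Defensive.

Import Order.TTheory GRing.Theory Num.Theory.
Import numFieldNormedType.Exports.

Local Open Scope classical_set_scope.
Local Open Scope ring_scope.
Local Open Scope complex_scope.
Local Open Scope cstar_scope.

#[local] Existing Instance summability.totally_filter.

(** * Real-valued norms *)

Section RealNorm.
Variables (R : realType) (V : normedModType R[i]).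
Implicit Types (x y : V) (r e : R).

Definition nr x : R := complex.Re `|x|.

Lemma normE x : `|x| = (nr x)%:C.
Proof. by rewrite /nr RRe_real// normr_real. Qed.

Lemma nr_ge0 x : 0 <= nr x.
Proof. by rewrite -lecR -normE normr_ge0. Qed.

Lemma nr0 : nr (0 : V) = 0.
Proof. by rewrite /nr normr0. Qed.

Lemma nr_eq0 x : nr x = 0 -> x = 0.
Proof. by move=> x0; apply/eqP; rewrite -normr_eq0 normE x0. Qed.

Lemma nrD x y : nr (x + y) <= nr x + nr y.
Proof. by rewrite -lecR rmorphD/= -!normE ler_normD. Qed.

Lemma nrN x : nr (- x) = nr x.
Proof. by rewrite /nr normrN. Qed.

Lemma nrBC x y : nr (x - y) = nr (y - x).
Proof. by rewrite -nrN opprB. Qed.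

Lemma nrB x y : nr (x - y) <= nr x + nr y.
Proof. by rewrite (le_trans (nrD _ _))// nrN. Qed.

Lemma nr_trans z x y : nr (x - y) <= nr (x - z) + nr (z - y).
Proof. by rewrite -[x - y](subrKA z) nrD. Qed.

Lemma ler_nrB x y : nr x <= nr y + nr (x - y).
Proof. by rewrite -[in leLHS](subrKC y x) nrD. Qed.

Lemma nrZ (a : R[i]) x : nr (a *: x) = complex.Re `|a| * nr x.
Proof.
have : (nr (a *: x))%:C = (complex.Re `|a| * nr x)%:C.
  by rewrite rmorphM/= -!normE normrZ.
by case.
Qed.

Lemma nrZr r x : nr (r%:C *: x) = `|r| * nr x.
Proof. by rewrite nrZ normc_def/= expr0n/= addr0 sqrtr_sqr. Qed.

Lemma nbhs_nrP x (A : set V) :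
  nbhs x A <-> exists2 e : R, 0 < e & [set y | nr (x - y) < e] `<=` A.
Proof.
rewrite -nbhs_ballE; split=> [[e /= e0 eA]|[e e0 eA]].
  have eE : e = (complex.Re e)%:C by rewrite RRe_real// gtr0_real.
  exists (complex.Re e); first by rewrite -ltcR -eE.
  move=> y /= xy; apply: eA; rewrite -ball_normE/= normE eE ltcR//.
exists e%:C; first by rewrite /= ltcR.
by move=> y; rewrite -ball_normE/= normE ltcR; exact: eA.
Qed.

Lemma cvg_nrP (T : Type) (F : set_system T) (f : T -> V) x : Filter F ->
  f @ F --> x <-> forall e, 0 < e -> F [set t | nr (x - f t) < e].
Proof.
move=> FF; split=> [fx e e0|H A].
  by apply: (fx [set y | nr (x - y) < e]); apply/nbhs_nrP; exists e.
move/nbhs_nrP => [e e0 eA].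
by apply: (@filterS _ F _ _ (f @^-1` A)) (H e e0) => t /= /eA.
Qed.

Lemma closed_nrP (D : set V) :
  closed D <->
  forall x, (forall e, 0 < e -> exists2 y, D y & nr (x - y) < e) -> D x.
Proof.
split=> [cD x H|H x cx].
  apply: cD => A /nbhs_nrP[e e0 eA].
  by have [y Dy xy] := H e e0; exists y; split => //; exact: eA.
apply: H => e e0.
have /cx[y [Dy xy]] : nbhs x [set y | nr (x - y) < e].
  by apply/nbhs_nrP; exists e.
by exists y.
Qed.

Lemma nr_ltP x : (forall e, 0 < e -> nr x <= e) -> x = 0.
Proof.
move=> H; apply/nr_eq0/eqP; rewrite eq_le nr_ge0 andbT.
by apply/ler_addgt0Pl => e e0; rewrite addr0 H.
Qed.

Definition nr_cauchy (F : set_system V) :=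
  forall e, 0 < e -> exists x, F [set y | nr (x - y) < e].

Lemma cauchy_nrP (F : set_system V) : ProperFilter F ->
  cauchy F <-> nr_cauchy F.
Proof.
move=> FF; split=> [/(cauchyP (R := R[i]) F) Fc e e0|Fc].
  have e0' : 0 < e%:C by rewrite ltcR.
  have [x Fx] := Fc _ e0'; exists x.
  by apply: filterS Fx => y; rewrite -ball_normE/= normE ltcR.
apply/(cauchyP (R := R[i]) F) => e e0.
have eE : e = (complex.Re e)%:C by rewrite RRe_real// gtr0_real.
have [|x Fx] := Fc (complex.Re e); first by rewrite -ltcR -eE.
by exists x; apply: filterS Fx => y /=; rewrite -ball_normE/= normE eE ltcR.
Qed.

Lemma linear_approx (k : R[i]) e : 0 < e -> exists2 d : R, 0 < d &
  forall x y x' y', nr (x - x') < d -> nr (y - y') < d ->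
    nr (k *: x + y - (k *: x' + y')) < e.
Proof.
move=> e0; have k0 : 0 <= complex.Re `|k| by rewrite normc_def/= sqrtr_ge0.
have k1 : 0 < complex.Re `|k| + 1 by rewrite ltr_wpDl.
exists (e / (complex.Re `|k| + 1)); first by rewrite divr_gt0.
move=> x y x' y' xx yy; rewrite opprD addrACA -scalerBr.
rewrite (le_lt_trans (nrD _ _))// nrZ -[ltRHS](divfK (lt0r_neq0 k1)).
by rewrite mulrDr mulr1 mulrC ler_ltD// ler_wpM2r// ltW.
Qed.

End RealNorm.

Lemma lipschitz_limit (R : realType) (V : normedModType R[i])
    (X : completeNormedModType R[i]) (f : V -> X) (K : R)
    (F : set_system V) : ProperFilter F -> nr_cauchy F ->
  (forall x y, nr (f x - f y) <= K * nr (x - y)) ->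
  exists l : X, f @ F --> l.
Proof.
move=> FF Fc fK; suff : cvg (f @ F) by move/cvg_ex.
apply: cauchy_cvg; apply/cauchy_nrP => e e0.
pose K' := Num.max K 1; have K0 : 0 < K' by rewrite lt_max ltr01 orbT.
have [|x Fx] := Fc (e / K'); first by rewrite divr_gt0.
exists (f x); apply: (@filterS _ F _ _ (f @^-1` _)) Fx => y /= xy.
rewrite (le_lt_trans (fK _ _))//.
rewrite (@le_lt_trans _ _ (K' * nr (x - y)))//.
  by rewrite ler_wpM2r ?nr_ge0// le_max lexx.
by rewrite mulrC -ltr_pdivlMr.
Qed.

Lemma le_nr_lim (R : realType) (T : Type) (V : normedModType R[i])
    (F : set_system T) (f : T -> V) (l : V) (K : R) : ProperFilter F ->
  f @ F --> l -> F [set t | nr (f t) <= K] -> nr l <= K.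
Proof.
move=> FF /cvg_nrP fl fK; apply/ler_addgt0Pr => e e0.
have [t /= [lt tK]] := filter_ex (filterI (fl e e0) fK).
by rewrite (le_trans (ler_nrB l (f t)))// lerD// ltW.
Qed.

Lemma nr_cvg_unique (R : realType) (T : Type) (V : normedModType R[i])
    (F : set_system T) (f : T -> V) (x y : V) : ProperFilter F ->
  f @ F --> x -> f @ F --> y -> x = y.
Proof.
move=> FF /cvg_nrP fx /cvg_nrP fy.
apply/eqP; rewrite -subr_eq0; apply/eqP/nr_ltP => e e0.
have e2 : 0 < e / 2 by rewrite divr_gt0.
have [t /= [tx ty]] := filter_ex (filterI (fx _ e2) (fy _ e2)).
rewrite (le_trans (nr_trans (f t) _ _))//; rewrite nrBC in ty; lra.
Qed.

(** * Elementary identities in C*-algebras *)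

Section CStarBasics.
Variables (R : realType) (A : cstarType R).
Implicit Types (x y z p : A) (r : R).

Lemma cmul0r x : 0 ** x = 0.
Proof. by rewrite -[0 in LHS](scale0r (0 : A)) scaler_cmull scale0r. Qed.

Lemma cmulr0 x : x ** 0 = 0.
Proof. by rewrite -[0 in LHS](scale0r (0 : A)) scaler_cmulr scale0r. Qed.

Lemma cmulNr x y : (- x) ** y = - (x ** y).
Proof. by rewrite -scaleN1r scaler_cmull scaleN1r. Qed.

Lemma cmulrN x y : x ** (- y) = - (x ** y).
Proof. by rewrite -scaleN1r scaler_cmulr scaleN1r. Qed.

Lemma cmulBl x y z : (x - y) ** z = x ** z - y ** z.
Proof. by rewrite cmulDl cmulNr. Qed.

Lemma cmulBr x y z : x ** (y - z) = x ** y - x ** z.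
Proof. by rewrite cmulDr cmulrN. Qed.

Lemma cmul_suml (I : Type) (s : seq I) (P : pred I) (f : I -> A) x :
  (\sum_(i <- s | P i) f i) ** x = \sum_(i <- s | P i) f i ** x.
Proof. by apply: (big_morph (cmul^~ x)) => [y z|]; rewrite ?cmulDl ?cmul0r. Qed.

Lemma cmul_sumr (I : Type) (s : seq I) (P : pred I) (f : I -> A) x :
  x ** (\sum_(i <- s | P i) f i) = \sum_(i <- s | P i) x ** f i.
Proof. by apply: (big_morph (cmul x)) => [y z|]; rewrite ?cmulDr ?cmulr0. Qed.

Lemma star0 : star (0 : A) = 0.
Proof. by rewrite -[0 in LHS](scale0r (0 : A)) starZ conjC0 scale0r. Qed.

Lemma starN x : star (- x) = - star x.
Proof. by apply/eqP; rewrite -addr_eq0 -starD addNr star0. Qed.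

Lemma starB x y : star (x - y) = star x - star y.
Proof. by rewrite starD starN. Qed.

Lemma star_sum (I : Type) (s : seq I) (P : pred I) (f : I -> A) :
  star (\sum_(i <- s | P i) f i) = \sum_(i <- s | P i) star (f i).
Proof. by apply: (big_morph (@star R A)) => [y z|]; rewrite ?starD ?star0. Qed.

Lemma starZr r x : star (r%:C *: x) = r%:C *: star x.
Proof. by rewrite starZ conj_Creal// complex_real. Qed.

Lemma nr_cmul x y : nr (x ** y) <= nr x * nr y.
Proof. by rewrite -lecR rmorphM/= -!normE normr_cmul_le. Qed.

Lemma nr_starM x : nr (star x ** x) = nr x ^+ 2.
Proof. by apply: complexI; rewrite rmorphXn/= -!normE normr_starM. Qed.

Lemma nr_star x : nr (star x) = nr x.
Proof.
suff le y : nr y <= nr (star y).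
  by apply/eqP; rewrite eq_le le -[in leRHS](starK x) le.
have [->|y0] := eqVneq (nr y) 0; first exact: nr_ge0.
have y_gt0 : 0 < nr y by rewrite lt_def y0 nr_ge0.
by rewrite -(ler_pM2r y_gt0) -expr2 -nr_starM nr_cmul.
Qed.

Lemma nr_Mstar x : nr (x ** star x) = nr x ^+ 2.
Proof. by rewrite -[x in x ** _]starK nr_starM nr_star. Qed.

Lemma starM_eq0 x : star x ** x = 0 -> x = 0.
Proof.
move=> x0; apply: nr_eq0; apply/eqP.
by rewrite -sqrf_eq0 -nr_starM x0 nr0.
Qed.

Lemma nr_projection p : projection p -> nr p <= 1.
Proof.
case=> sp pp; have : nr p = nr p ^+ 2 by rewrite -nr_starM sp pp.
have [->|p0 pE] := eqVneq (nr p) 0; first by rewrite ler01.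
have : nr p * 1 = nr p * nr p by rewrite mulr1 -expr2.
by move/(mulfI p0) => <-.
Qed.

Lemma cmul_approx x y x' y' (d : R) : d <= 1 ->
  nr (x - x') < d -> nr (y - y') < d ->
  nr (x ** y - x' ** y') < d * (nr x + nr y + 1).
Proof.
move=> d1 xx yy.
have -> : x ** y - x' ** y' = x ** (y - y') + (x - x') ** y'.
  by rewrite cmulBr cmulBl addrA subrK.
rewrite (le_lt_trans (nrD _ _))//.
have h1 := nr_cmul x (y - y'); have h2 := nr_cmul (x - x') y'.
have h3 := ler_nrB y' y; rewrite nrBC in h3.
have p3 := nr_ge0 y; have p5 := nr_ge0 x.
have q1 : nr x * nr (y - y') <= nr x * d by rewrite ler_wpM2l// ltW.
have q2 : nr (x - x') * nr y' <= nr (x - x') * (nr y + 1).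
  by rewrite ler_wpM2l ?nr_ge0//; lra.
have q3 : nr (x - x') * (nr y + 1) < d * (nr y + 1).
  by rewrite ltr_pM2r//; lra.
lra.
Qed.

End CStarBasics.

(** * The C*-algebra of adjointable operators *)

(** A Hilbert module is recorded through its inner product: adjointability makes
    an operator linear, and the Cauchy-Schwarz inequality yields the
    C*-identity of the operator norm. *)
Record hilbert_module (R : realType) (D : cstarType R) := HilbertModule {
  hm_car :> completeNormedModType R[i];
  ip : hm_car -> hm_car -> D;
  ipDr : forall x y z, ip x (y + z) = ip x y + ip x z;
  ipZr : forall a x y, ip x (a *: y) = a *: ip x y;
  star_ip : forall x y, star (ip x y) = ip y x;
  nr_ip : forall x, nr (ip x x) = nr x ^+ 2;
  ip_cauchy_schwarz : forall x y, nr (ip x y) <= nr x * nr y }.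

Section Adjointable.
Variables (R : realType) (D : cstarType R) (H : hilbert_module D).
Implicit Types (x y z : H) (K : R).

Lemma ipDl x y z : ip (x + y) z = ip x z + ip y z.
Proof. by rewrite -star_ip ipDr starD !star_ip. Qed.

Lemma ipZl a x y : ip (a *: x) y = Num.conj a *: ip x y.
Proof. by rewrite -star_ip ipZr starZ star_ip. Qed.

Lemma ipNr x y : ip x (- y) = - ip x y.
Proof. by rewrite -scaleN1r ipZr scaleN1r. Qed.

Lemma ipBr x y z : ip x (y - z) = ip x y - ip x z.
Proof. by rewrite ipDr ipNr. Qed.

Lemma ipNl x y : ip (- x) y = - ip x y.
Proof. by rewrite -star_ip ipNr starN star_ip. Qed.

Lemma ipBl x y z : ip (x - y) z = ip x z - ip y z.
Proof. by rewrite ipDl ipNl. Qed.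

Lemma ip0l y : ip 0 y = 0.
Proof. by rewrite -(subrr (0 : H)) ipBl subrr. Qed.

Lemma ip_inj x y : (forall z, ip x z = ip y z) -> x = y.
Proof.
move=> xy; apply/eqP; rewrite -subr_eq0; apply/eqP/nr_eq0/eqP.
by rewrite -sqrf_eq0 -nr_ip ipBl xy subrr nr0.
Qed.

Definition adjointable (f : H -> H) : Prop :=
  exists g, (forall x y, ip (f x) y = ip x (g y)) /\
  exists K, forall x, nr (f x) <= K * nr x /\ nr (g x) <= K * nr x.

Definition adjointable_pred : {pred H -> H} := fun f => `[< adjointable f >].

Lemma adjointable_submod : submod_closed adjointable_pred.
Proof.
split=> [|a f g /asboolP[f' [ff' [K fK]]] /asboolP[g' [gg' [L gL]]]].
  apply/asboolP; exists 0; split=> [x y|]; first by rewrite ip0l -star_ip ip0l star0.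
  by exists 0 => x; rewrite mul0r nr0.
apply/asboolP; exists (Num.conj a *: f' + g'); split=> [x y|].
  by rewrite ipDl ipZl ff' gg' -ipZr -ipDr.
exists (complex.Re `|a| * K + L) => x; rewrite mulrDl -mulrA.
have [fKx f'K] := fK x; have [gLx g'L] := gL x.
have a0 : 0 <= complex.Re `|a| by rewrite normc_def/= sqrtr_ge0.
split; apply: (le_trans (nrD _ _)); apply: lerD => //=.
  by rewrite nrZ ler_wpM2l.
by rewrite nrZ norm_conjC ler_wpM2l.
Qed.

HB.instance Definition _ :=
  GRing.isSubmodClosed.Build _ _ adjointable_pred adjointable_submod.

Record adj := Adj { adj_fun :> H -> H; adj_subproof : adj_fun \in adjointable_pred }.

HB.instance Definition _ := [isSub for adj_fun].
HB.instance Definition _ := [Choice of adj by <:].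
HB.instance Definition _ := [SubChoice_isSubLmodule of adj by <:].

Implicit Types f g h : adj.

Lemma adjP f : adjointable f.
Proof. by case: f => f fP /=; apply/asboolP; exact: fP. Qed.

Lemma adj_ext f g : (forall x, f x = g x) -> f = g.
Proof. by move=> fg; apply/val_inj/funext. Qed.

Definition mk_adj (f : H -> H) (hf : adjointable f) : adj := Adj (asboolT hf).

Lemma adj_subE f g x : (f - g) x = f x - g x. Proof. by []. Qed.
Lemma adj_scaleE a f x : (a *: f) x = a *: f x. Proof. by []. Qed.

Definition adj_star_fun f : H -> H := sval (cid (adjP f)).

Lemma ip_adj_star_fun f x y : ip (f x) y = ip x (adj_star_fun f y).
Proof. by rewrite /adj_star_fun; case: cid => g /= [->]. Qed.

Lemma adj_star_fun_adjointable f : adjointable (adj_star_fun f).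
Proof.
exists f; split=> [x y|]; first by rewrite -star_ip -ip_adj_star_fun star_ip.
rewrite /adj_star_fun; case: cid => g /= [_ [K fK]].
by exists K => x; have [] := fK x.
Qed.

Definition adj_star f := mk_adj (adj_star_fun_adjointable f).

Lemma ip_adj f x y : ip (f x) y = ip x (adj_star f y).
Proof. exact: ip_adj_star_fun. Qed.

Lemma ip_adjV f x y : ip (adj_star f x) y = ip x (f y).
Proof. by rewrite -star_ip -ip_adj star_ip. Qed.

Lemma adj_starE f g : (forall x y, ip (f x) y = ip x (g y)) -> adj_star f = g.
Proof.
move=> fg; apply: adj_ext => x; apply: ip_inj => z.
by rewrite ip_adjV -star_ip fg star_ip.
Qed.

Lemma adj_mul_adjointable f g : adjointable (f \o g).
Proof.
exists (adj_star g \o adj_star f); split=> [x y|]; first by rewrite /= !ip_adj.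
have [f' [ff' [K fK]]] := adjP f; have [g' [gg' [L gL]]] := adjP g.
have f'E y : adj_star_fun f y = f' y.
  by apply: ip_inj => z; rewrite -star_ip -ip_adj_star_fun ff' star_ip.
have g'E y : adj_star_fun g y = g' y.
  by apply: ip_inj => z; rewrite -star_ip -ip_adj_star_fun gg' star_ip.
pose M := Num.max 0 K; have M0 : 0 <= M by rewrite le_max lexx.
pose N := Num.max 0 L; have N0 : 0 <= N by rewrite le_max lexx.
have fM x : nr (f x) <= M * nr x /\ nr (f' x) <= M * nr x.
  have [h1 h2] := fK x; have KM : K <= M by rewrite le_max lexx orbT.
  by split; [apply: (le_trans h1)|apply: (le_trans h2)];
     rewrite ler_wpM2r// nr_ge0.
have gN x : nr (g x) <= N * nr x /\ nr (g' x) <= N * nr x.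
  have [h1 h2] := gL x; have LN : L <= N by rewrite le_max lexx orbT.
  by split; [apply: (le_trans h1)|apply: (le_trans h2)];
     rewrite ler_wpM2r// nr_ge0.
exists (M * N) => x; split => /=.
  by rewrite (le_trans (fM _).1)// -mulrA ler_wpM2l// (gN _).1.
by rewrite f'E g'E (le_trans (gN _).2)// [M * N]mulrC -mulrA ler_wpM2l// (fM _).2.
Qed.

Definition adj_mul f g := mk_adj (adj_mul_adjointable f g).

Lemma adj_one_adjointable : adjointable id.
Proof. by exists id; split=> //; exists 1 => x; rewrite mul1r. Qed.

Definition adj_one := mk_adj adj_one_adjointable.

Lemma adj_linear f a x y : f (a *: x + y) = a *: f x + f y.
Proof.
by apply: ip_inj => z; rewrite ip_adj !ipDl !ipZl !ip_adj.
Qed.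

Lemma adj_fun0 f : f 0 = 0.
Proof. by apply: ip_inj => z; rewrite ip_adj !ip0l. Qed.

Lemma adj_funD f x y : f (x + y) = f x + f y.
Proof. by have := adj_linear f 1 x y; rewrite !scale1r. Qed.

Lemma adj_funZ f a x : f (a *: x) = a *: f x.
Proof. by have := adj_linear f a x 0; rewrite adj_fun0 !addr0. Qed.

Definition opnr f : R := sup [set nr (f x) | x in [set x | nr x <= 1]].

Let opnr_nonempty f : [set nr (f x) | x in [set x | nr x <= 1]] !=set0.
Proof. by exists (nr (f 0)); exists 0 => //=; rewrite nr0 ler01. Qed.

Let opnr_has_ub f : has_ubound [set nr (f x) | x in [set x | nr x <= 1]].
Proof.
have [g [_ [K fK]]] := adjP f; exists (Num.max 0 K) => _ [x /= x1 <-].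
rewrite (le_trans (fK x).1)// (@le_trans _ _ (Num.max 0 K * nr x))//.
  by rewrite ler_wpM2r ?nr_ge0// le_max lexx orbT.
by rewrite ler_piMr// le_max lexx.
Qed.

Lemma opnr_ge0 f : 0 <= opnr f.
Proof.
have /(@ub_le_sup _ _ (opnr_has_ub f)) :
  [set nr (f x) | x in [set x | nr x <= 1]] (nr (f 0)).
  by exists 0 => //=; rewrite nr0 ler01.
by rewrite adj_fun0 nr0.
Qed.

Lemma le_opnr f x : nr (f x) <= opnr f * nr x.
Proof.
have [x0|x0] := eqVneq (nr x) 0.
  by rewrite (nr_eq0 x0) adj_fun0 !nr0 mulr0.
have nx0 : 0 < nr x by rewrite lt_def x0 nr_ge0.
have -> : nr (f x) = nr (f ((nr x)^-1%:C *: x)) * nr x.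
  by rewrite adj_funZ nrZr ger0_norm ?invr_ge0 ?nr_ge0// mulrAC mulVf// mul1r.
rewrite ler_wpM2r ?nr_ge0//; apply: ub_le_sup; first exact: opnr_has_ub.
exists ((nr x)^-1%:C *: x) => //=.
by rewrite nrZr ger0_norm ?invr_ge0 ?nr_ge0// mulVf.
Qed.

Lemma opnr_le f K : 0 <= K -> (forall x, nr (f x) <= K * nr x) -> opnr f <= K.
Proof.
move=> K0 fK; apply: ge_sup; first exact: opnr_nonempty.
by move=> _ [x /= x1 <-]; rewrite (le_trans (fK x))// ler_piMr.
Qed.

Definition adj_norm f : R[i] := (opnr f)%:C.

Lemma adj_normD f g : adj_norm (f + g) <= adj_norm f + adj_norm g.
Proof.
rewrite -rmorphD lecR; apply: opnr_le => [|x]; first by rewrite addr_ge0 ?opnr_ge0.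
by rewrite mulrDl (le_trans (nrD _ _))// lerD// le_opnr.
Qed.

Lemma opnrZ_le (a : R[i]) f : opnr (a *: f) <= complex.Re `|a| * opnr f.
Proof.
have a0 : 0 <= complex.Re `|a| by rewrite normc_def/= sqrtr_ge0.
apply: opnr_le => [|x]; first by rewrite mulr_ge0 ?opnr_ge0.
by rewrite adj_scaleE nrZ -mulrA ler_wpM2l// le_opnr.
Qed.

Lemma adj_normZ (a : R[i]) f : adj_norm (a *: f) = `|a| * adj_norm f.
Proof.
have aE (b : R[i]) : `|b| = (complex.Re `|b|)%:C by rewrite normc_def.
rewrite aE -rmorphM; congr (_%:C).
apply/eqP; rewrite eq_le opnrZ_le andTb.
have [->|a0] := eqVneq a 0.
  by rewrite scale0r normr0 mul0r opnr_ge0.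
have na0 : 0 < complex.Re `|a| by rewrite -ltcR -aE normr_gt0.
have := opnrZ_le a^-1 (a *: f); rewrite scalerA mulVf// scale1r => h.
rewrite -ler_pdivlMl//; apply: (le_trans h).
rewrite normfV aE -fmorphV/=.
by [].
Qed.

Lemma adj_norm0_eq0 f : adj_norm f = 0 -> f = 0.
Proof.
case=> f0; apply: adj_ext => x; apply/nr_eq0/eqP.
by rewrite eq_le nr_ge0 (le_trans (le_opnr _ _))// f0 mul0r.
Qed.

HB.instance Definition _ := Lmodule_isNormed.Build R[i] adj
  adj_normD adj_normZ adj_norm0_eq0.

Lemma nr_adj_app f x : nr (f x) <= nr f * nr x.
Proof. exact: le_opnr. Qed.

Lemma nr_adj_le f K : 0 <= K -> (forall x, nr (f x) <= K * nr x) -> nr f <= K.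
Proof. exact: opnr_le. Qed.

Lemma nr_adj_star_le f : nr (adj_star f) <= nr f.
Proof.
apply: nr_adj_le => [|x]; first exact: nr_ge0.
have [->|x0] := eqVneq (nr (adj_star f x)) 0; first by rewrite mulr_ge0 ?nr_ge0.
have nx0 : 0 < nr (adj_star f x) by rewrite lt_def x0 nr_ge0.
rewrite -(ler_pM2r nx0) -expr2 -nr_ip -ip_adj.
rewrite (le_trans (ip_cauchy_schwarz _ _))// mulrAC ler_wpM2r ?nr_ge0//.
exact: nr_adj_app.
Qed.

(** The operator norm is complete: a Cauchy filter of operators converges
    pointwise, and so does the filter of adjoints. *)
Lemma adj_complete (F : set_system adj) : ProperFilter F -> cauchy F -> cvg F.
Proof.
move=> FF /cauchy_nrP Fc.
have lim1 x : exists l, f x @[f --> F] --> (l : H).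
  apply: (lipschitz_limit (K := nr x) FF Fc) => f g.
  by rewrite -adj_subE mulrC nr_adj_app.
have lim2 x : exists l, adj_star f x @[f --> F] --> (l : H).
  apply: (lipschitz_limit (K := nr x) FF Fc) => f g.
  have -> : adj_star f x - adj_star g x = adj_star (f - g) x.
    by apply: ip_inj => z; rewrite ipBl !ip_adjV -ipBr.
  by rewrite mulrC (le_trans (nr_adj_app _ _))// ler_wpM2r ?nr_ge0// nr_adj_star_le.
pose l x := sval (cid (lim1 x)); pose l' x := sval (cid (lim2 x)).
have lP x : f x @[f --> F] --> (l x : H) by rewrite /l; case: cid.
have l'P x : adj_star f x @[f --> F] --> (l' x : H) by rewrite /l'; case: cid.
have [f0 F0] := Fc 1 ltr01.
have bd x : nr (l x) <= (nr f0 + 1) * nr x.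
  apply: (le_nr_lim FF (lP x)); apply: filterS F0 => f /= /ltW ff0.
  rewrite (le_trans (nr_adj_app _ _))// ler_wpM2r ?nr_ge0//.
  by rewrite (le_trans (ler_nrB f f0))// lerD2l nrBC.
have bd' x : nr (l' x) <= (nr f0 + 1) * nr x.
  apply: (le_nr_lim FF (l'P x)); apply: filterS F0 => f /= /ltW ff0.
  apply: (le_trans (nr_adj_app (adj_star f) x)); rewrite ler_wpM2r ?nr_ge0//.
  rewrite (le_trans (nr_adj_star_le _))//.
  by rewrite (le_trans (ler_nrB f f0))// lerD2l nrBC.
have ll' : adjointable l.
  exists l'; split; last by exists (nr f0 + 1).
  move=> x y; apply/eqP; rewrite -subr_eq0; apply/eqP/nr_ltP => e e0.
  pose d := e / (nr x + nr y + 1).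
  have s0 : 0 < nr x + nr y + 1 by rewrite ltr_wpDl// addr_ge0 ?nr_ge0.
  have d0 : 0 < d by rewrite divr_gt0.
  have /cvg_nrP/(_ d d0) h1 := lP x; have /cvg_nrP/(_ d d0) h2 := l'P y.
  have [f /= [k1 k2]] := filter_ex (filterI h1 h2).
  have -> : ip (l x) y - ip x (l' y) =
            ip (l x - f x) y - ip x (l' y - adj_star f y).
    by rewrite ipBl ipBr -ip_adj opprB addrA subrK.
  rewrite (le_trans (nrB _ _))// (le_trans (lerD (ip_cauchy_schwarz _ _) (ip_cauchy_schwarz _ _)))//.
  have -> : e = d * (nr x + nr y + 1) by rewrite /d divfK// gt_eqF.
  have := ler_wpM2r (nr_ge0 y) (ltW k1); have := ler_wpM2l (nr_ge0 x) (ltW k2).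
  rewrite -!/(nr _) => u1 u2; rewrite !mulrDr mulr1 [d * nr x]mulrC; lra.
apply/cvg_ex; exists (mk_adj ll'); apply/cvg_nrP => e e0.
have e20 : 0 < e / 2 by rewrite divr_gt0.
have [g Fg] := Fc _ (divr_gt0 e20 (ltr0Sn _ 1)).
apply: filterS (Fg) => h /= gh; rewrite (@le_lt_trans _ _ (e / 2))//; last lra.
apply: nr_adj_le => [|x]; first exact: ltW.
rewrite adj_subE -nrN opprB.
have lx : h x - f x @[f --> F] --> h x - l x by apply: cvgB; [exact: cvg_cst|exact: lP].
apply: (le_nr_lim FF lx); apply: filterS (Fg) => f /= gf.
rewrite -adj_subE (le_trans (nr_adj_app _ _))// ler_wpM2r ?nr_ge0//.
rewrite (le_trans (nr_trans g _ _))//; rewrite nrBC in gh; lra.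
Qed.

HB.instance Definition _ := Uniform_isComplete.Build adj adj_complete.

Lemma adj_mulA : associative adj_mul.
Proof. by move=> f g h; apply: adj_ext. Qed.

Lemma adj_mulDl : left_distributive adj_mul +%R.
Proof. by move=> f g h; apply: adj_ext. Qed.

Lemma adj_mulDr : right_distributive adj_mul +%R.
Proof. by move=> f g h; apply: adj_ext => x; rewrite /= adj_funD. Qed.

Lemma adj_scalel a f g : adj_mul (a *: f) g = a *: adj_mul f g.
Proof. exact: adj_ext. Qed.

Lemma adj_scaler a f g : adj_mul f (a *: g) = a *: adj_mul f g.
Proof. by apply: adj_ext => x; rewrite /= adj_funZ. Qed.

Lemma adj_starK : involutive adj_star.
Proof. by move=> f; apply: adj_starE => x y; rewrite ip_adjV. Qed.

Lemma adj_starD : {morph adj_star : f g / f + g}.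
Proof. by move=> f g; apply: adj_starE => x y; rewrite ipDl !ip_adj -ipDr. Qed.

Lemma adj_starZ a f : adj_star (a *: f) = Num.conj a *: adj_star f.
Proof. by apply: adj_starE => x y; rewrite ipZl !ip_adj -ipZr. Qed.

Lemma adj_starM f g : adj_star (adj_mul f g) = adj_mul (adj_star g) (adj_star f).
Proof. by apply: adj_starE => x y; rewrite /= !ip_adj. Qed.

Lemma nr_adj_mul f g : nr (adj_mul f g) <= nr f * nr g.
Proof.
apply: nr_adj_le => [|x]; first by rewrite mulr_ge0 ?nr_ge0.
by rewrite /= (le_trans (nr_adj_app _ _))// -mulrA ler_wpM2l ?nr_ge0// nr_adj_app.
Qed.

(** The C*-identity: |f x|^2 = |<x, f* f x>| is at most |f* f| |x|^2. *)
Lemma nr_adj_starM f : nr (adj_mul (adj_star f) f) = nr f ^+ 2.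
Proof.
apply/eqP; rewrite eq_le; apply/andP; split.
  by rewrite (le_trans (nr_adj_mul _ _))// expr2 ler_wpM2r ?nr_ge0// nr_adj_star_le.
rewrite -[leRHS]sqr_sqrtr ?nr_ge0// lerXn2r ?nnegrE ?nr_ge0 ?sqrtr_ge0//.
apply: nr_adj_le => [|x]; first exact: sqrtr_ge0.
rewrite -(@ler_pXn2r _ 2)// ?nnegrE ?mulr_ge0 ?sqrtr_ge0 ?nr_ge0//.
rewrite exprMn sqr_sqrtr ?nr_ge0// -nr_ip ip_adj.
rewrite (le_trans (ip_cauchy_schwarz _ _))// expr2 mulrCA ler_wpM2l ?nr_ge0//.
exact: (nr_adj_app (adj_mul (adj_star f) f)).
Qed.

Lemma adj_normM f g : `|adj_mul f g| <= `|f| * `|g|.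
Proof. by rewrite !normE -rmorphM lecR nr_adj_mul. Qed.

Lemma adj_norm_starM f : `|adj_mul (adj_star f) f| = `|f| ^+ 2.
Proof. by rewrite !normE nr_adj_starM rmorphXn. Qed.

HB.instance Definition _ := isCStar.Build R adj adj_mulA adj_mulDl adj_mulDr
  adj_scalel adj_scaler adj_starK adj_starD adj_starZ adj_starM
  adj_normM adj_norm_starM.

Lemma adj_mulE f g x : (f ** g) x = f (g x). Proof. by []. Qed.

Lemma ip_star f x y : ip (f x) y = ip x (star f y).
Proof. exact: ip_adj. Qed.

Lemma starP f g : (forall x y, ip (f x) y = ip x (g y)) -> star f = g.
Proof. exact: adj_starE. Qed.

Lemma adj1l f : adj_one ** f = f. Proof. exact: adj_ext. Qed.
Lemma adj1r f : f ** adj_one = f. Proof. exact: adj_ext. Qed.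

End Adjointable.

(** * Square roots by iteration *)

Lemma scaler2C (R : realType) (V : lmodType R[i]) (x : V) : 2%:C *: x = x + x.
Proof. by rewrite rmorph_nat scaler_nat mulr2n. Qed.

Section SquareRoot.
Variables (R : realType) (A : cstarType R) (x : A).
Hypothesis x1 : nr x <= 1.

Let y : nat -> A := fix y n :=
  if n is n'.+1 then (2^-1)%:C *: (x + y n' ** y n') else 0.
Let r : nat -> R := fix r n :=
  if n is n'.+1 then 2^-1 * (1 + r n' ^+ 2) else 0.

Let yS n : y n.+1 = (2^-1)%:C *: (x + y n ** y n). Proof. by []. Qed.
Let rS n : r n.+1 = 2^-1 * (1 + r n ^+ 2). Proof. by []. Qed.

Let half_ge0 : 0 <= 2^-1 :> R. Proof. by rewrite invr_ge0. Qed.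

Let r_ge0 n : 0 <= r n.
Proof. by case: n => [|n] //=; rewrite mulr_ge0// addr_ge0// sqr_ge0. Qed.

Let r_le1 n : r n <= 1.
Proof.
elim: n => [|n IH] /=; first exact: ler01.
have : r n ^+ 2 <= 1 by rewrite expr_le1.
lra.
Qed.

Let nr_y n : nr (y n) <= r n.
Proof.
elim: n => [|n IH] /=; first by rewrite nr0.
rewrite nrZr ger0_norm// ler_wpM2l//.
rewrite (le_trans (nrD _ _))// lerD// (le_trans (nr_cmul _ _))// expr2.
by rewrite ler_pM ?nr_ge0.
Qed.

Let nr_yS n : nr (y n.+1 - y n) <= r n.+1 - r n.
Proof.
elim: n => [|n IH].
  rewrite /= !subr0 cmul0r addr0 nrZr ger0_norm// ler_wpM2l//.
  by rewrite expr0n addr0.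
have -> : y n.+2 - y n.+1 =
    (2^-1)%:C *: (y n.+1 ** (y n.+1 - y n) + (y n.+1 - y n) ** y n).
  rewrite (yS n.+1) [in X in _ - X]yS -scalerBr opprD addrACA subrr add0r.
  by rewrite cmulBr cmulBl addrA subrK.
rewrite nrZr ger0_norm//.
have -> : r n.+2 - r n.+1 = 2^-1 * (r n.+1 * (r n.+1 - r n) + (r n.+1 - r n) * r n).
  by rewrite (rS n.+1); have := rS n; lra.
rewrite ler_wpM2l// (le_trans (nrD _ _))// lerD// (le_trans (nr_cmul _ _))//.
  by rewrite ler_pM ?nr_ge0.
by rewrite ler_pM ?nr_ge0.
Qed.

Let nr_yB n k : nr (y (n + k)%N - y n) <= r (n + k)%N - r n.
Proof.
elim: k => [|k IH]; first by rewrite addn0 !subrr nr0.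
rewrite addnS (le_trans (nr_trans (y (n + k)%N) _ _))//.
by have := nr_yS (n + k); lra.
Qed.

Let y_lim : exists l : A, forall e, 0 < e ->
  exists n, nr (l - y n) < e /\ nr (l - y n.+1) < e.
Proof.
have rL : has_sup [set r n | n in setT].
  by split; [exists (r 0), 0|exists 1 => _ [n _ <-]].
have Fc : nr_cauchy (y @ \oo).
  move=> e e0; have [_ [n _ <-] rn] := sup_adherent e0 rL.
  exists (y n); exists n => // m /= nm; rewrite nrBC -(subnKC nm).
  apply: (le_lt_trans (nr_yB _ _)).
  have : r (n + (m - n))%N <= sup [set r n | n in setT].
    by apply: ub_le_sup; [case: rL|exists (n + (m - n))%N].
  lra.
have /cvg_ex[l yl] : cvg (y @ \oo) by apply: cauchy_cvg; apply/cauchy_nrP.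
exists l => e e0; have /cvg_nrP/(_ e e0)[n _ nl] := yl.
by exists n; split; apply: nl => /=.
Qed.

(** Without a unit, l stands for 1 - (1 - x)^(1/2), the limit of the iteration
    y := (x + y^2)/2 from 0.  The real iteration with 1 in place of x increases
    to a limit and its increments dominate those of y, whence convergence on the
    whole closed unit ball.  Selfadjointness and commutation pass from x to the
    iterates and to the limit. *)
Lemma iterated_square_root : exists l : A,
  [/\ x = 2%:C *: l - l ** l, nr l <= 1, (star x = x -> star l = l) &
      forall z, z ** x = x ** z -> z ** l = l ** z].
Proof.
have [l yl] := y_lim; exists l.
have l1 : nr l <= 1.
  apply/ler_addgt0Pr => e e0; have [n [ln _]] := yl e e0.
  rewrite (le_trans (ler_nrB l (y n)))// lerD//; last exact: ltW.
  exact: le_trans (nr_y n) (r_le1 n).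
split=> //.
- have -> : 2%:C *: l - l ** l = x + 2%:C *: (l - (2^-1)%:C *: (x + l ** l)).
    rewrite scalerBr scalerA -rmorphM/= divff// scale1r.
    by rewrite opprD addrCA addNKr.
  rewrite -[LHS]addr0; congr (_ + _).
  suff -> : l - (2^-1)%:C *: (x + l ** l) = 0 by rewrite scaler0.
  apply: nr_ltP => e e0; have e2 : 0 < e / 2 by rewrite divr_gt0.
  have [n [ln lSn]] := yl _ e2.
  rewrite (le_trans (nr_trans (y n.+1) _ _))//= -scalerBr opprD addrACA subrr add0r.
  have -> : y n ** y n - l ** l = - (l ** (l - y n) + (l - y n) ** y n).
    by rewrite cmulBr cmulBl addrA subrK opprB.
  rewrite nrZr nrN ger0_norm//.
  have h1 : nr ((l - y n) ** y n) <= nr (l - y n).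
    rewrite (le_trans (nr_cmul _ _))// ler_piMr ?nr_ge0//.
    exact: le_trans (nr_y n) (r_le1 n).
  have h2 : nr (l ** (l - y n)) <= nr (l - y n).
    by rewrite (le_trans (nr_cmul _ _))// ler_piMl ?nr_ge0.
  have h3 := nrD (l ** (l - y n)) ((l - y n) ** y n).
  move: lSn; rewrite [y n.+1]/= => lSn; lra.
- move=> sx; have sy n : star (y n) = y n.
    by elim: n => [|n IH] /=; rewrite ?star0// starZr starD starM sx IH.
  apply/eqP; rewrite -subr_eq0; apply/eqP/nr_ltP => e e0.
  have e2 : 0 < e / 2 by rewrite divr_gt0.
  have [n [ln _]] := yl _ e2.
  rewrite (le_trans (nr_trans (y n) _ _))//.
  have -> : nr (star l - y n) = nr (l - y n) by rewrite -[in LHS]sy -starB nr_star.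
  by rewrite [X in _ + X]nrBC; lra.
move=> z zx; have zy n : z ** y n = y n ** z.
  elim: n => [|n IH] /=; first by rewrite cmul0r cmulr0.
  by rewrite scaler_cmulr scaler_cmull cmulDr cmulDl zx cmulA IH -cmulA IH cmulA.
apply/eqP; rewrite -subr_eq0; apply/eqP/nr_ltP => e e0.
have z0 : 0 < 2 * nr z + 1 by rewrite ltr_wpDl// mulr_ge0 ?nr_ge0.
have e2 : 0 < e / (2 * nr z + 1) by rewrite divr_gt0.
have [n [ln _]] := yl _ e2.
have -> : z ** l - l ** z = z ** (l - y n) - (l - y n) ** z.
  by rewrite cmulBr cmulBl zy opprB addrA subrK.
rewrite (le_trans (nrB _ _))//.
have h1 := nr_cmul z (l - y n); have h2 := nr_cmul (l - y n) z.
have : nr (l - y n) * (2 * nr z + 1) <= e.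
  by rewrite -ler_pdivlMr// ltW.
by have := nr_ge0 (l - y n); nra.
Qed.

End SquareRoot.

(** * Positive elements of a unital C*-algebra *)

Section Positivity.
Variables (R : realType) (U : cstarType R) (e : U).
Hypotheses (e1l : forall x, e ** x = x) (e1r : forall x, x ** e = x).
Implicit Types (a b h k x y z : U) (r s t : R).

Lemma star_unit : star e = e.
Proof. by rewrite -[LHS]e1r -[in RHS](starK e) -[in RHS](e1r (star e)) starM starK. Qed.

Lemma nr_unit_le1 : nr e <= 1.
Proof. by apply: nr_projection; split; [exact: star_unit|exact: e1l]. Qed.

Lemma nr_scalar r : nr (r%:C *: e) <= `|r|.
Proof. by rewrite nrZr ler_piMr// nr_unit_le1. Qed.

Lemma conj_i : Num.conj ('i%C : R[i]) = - 'i%C.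
Proof. by rewrite complexiE conjCi. Qed.

(** If k and m commute, then v = m + i k satisfies v* v = r, and k is the
    imaginary part of v. *)

(** If k and m commute, then v = m + i k satisfies v* v = r, and k is the
    imaginary part of v. *)
Lemma nr_le_of_squares k m r : 0 <= r -> star k = k -> star m = m ->
  k ** m = m ** k -> k ** k + m ** m = r%:C *: e -> nr k ^+ 2 <= r.
Proof.
move=> r0 sk sm km kmr; pose v := m + 'i%C *: k.
have sv : star v = m - 'i%C *: k by rewrite starD starZ sm sk conj_i scaleNr.
have vv : star v ** v = r%:C *: e.
  rewrite sv /v cmulBl !cmulDr !scaler_cmull !scaler_cmulr km scalerA.
  by rewrite -expr2 sqr_i scaleN1r opprD opprK addrA addrK addrC.
have nv : nr v ^+ 2 <= r.
  by rewrite -nr_starM vv (le_trans (nr_scalar _))// ger0_norm.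
have kv : nr k <= nr v.
  have : nr (v - star v) = 2 * nr k.
    rewrite sv /v opprB addrC subrKA -scalerDr nrZ normc_def /= expr0n expr1n.
    by rewrite add0r sqrtr1 mul1r -scaler2C nrZr ger0_norm.
  have := nrB v (star v); rewrite nr_star; lra.
by apply: le_trans nv; rewrite ler_sqr ?nnegrE ?nr_ge0.
Qed.

(** For selfadjoint h the inequality says that the spectrum lies in [0, 2 t]; in
    this form sums of positive elements are positive by the triangle
    inequality. *)
Definition pos h : Prop :=
  star h = h /\ exists2 t, 0 <= t & nr (t%:C *: e - h) <= t.

Lemma pos_star h : pos h -> star h = h. Proof. by case. Qed.

Lemma scalar_star r : star (r%:C *: e) = r%:C *: e.
Proof. by rewrite starZr star_unit. Qed.

Lemma posD h k : pos h -> pos k -> pos (h + k).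
Proof.
move=> [sh [t t0 ht]] [sk [s s0 ks]]; split; first by rewrite starD sh sk.
exists (t + s); first exact: addr_ge0.
by rewrite rmorphD scalerDl opprD addrACA (le_trans (nrD _ _))// lerD.
Qed.

Lemma posZ r h : 0 <= r -> pos h -> pos (r%:C *: h).
Proof.
move=> r0 [sh [t t0 ht]]; split; first by rewrite starZr sh.
exists (r * t); first exact: mulr_ge0.
by rewrite rmorphM -scalerA -scalerBr nrZr ger0_norm// ler_wpM2l.
Qed.

Lemma pos0 : pos 0.
Proof. by split; [exact: star0|exists 0 => //; rewrite scale0r subr0 nr0]. Qed.

Lemma pos_scalar r : 0 <= r -> pos (r%:C *: e).
Proof.
move=> r0; split; first exact: scalar_star.
by exists r => //; rewrite subrr nr0.
Qed.

Lemma pos_nr b : star b = b -> pos ((nr b)%:C *: e - b).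
Proof.
move=> sb; split; first by rewrite starB scalar_star sb.
by exists (nr b); rewrite ?nr_ge0// opprB addrC subrK.
Qed.

(** The inequality |t - h| <= t puts h in the form t (1 - x) with |x| <= 1. *)
Lemma pos_sqrt h : pos h -> exists k,
  [/\ pos k, k ** k = h & forall z, z ** h = h ** z -> z ** k = k ** z].
Proof.
move=> [sh [t' t'0 ht']]; pose t := t' + 1.
have t0 : 0 < t by rewrite ltr_wpDl.
have ht : nr (t%:C *: e - h) <= t.
  rewrite rmorphD scalerDl addrAC (le_trans (nrD _ _))// lerD//.
  by rewrite (le_trans (nr_scalar _))// normr1.
pose x := e - t^-1%:C *: h.
have x1 : nr x <= 1.
  have -> : x = t^-1%:C *: (t%:C *: e - h).
    by rewrite scalerBr scalerA -rmorphM/= mulVf ?gt_eqF// scale1r.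
  by rewrite nrZr ger0_norm ?invr_ge0 ?(ltW t0)// mulrC ler_pdivrMr// mul1r.
have sx : star x = x by rewrite starB star_unit starZr sh.
have [l [xl l1 sl lz]] := iterated_square_root x1.
pose r := Num.sqrt t.
have rr : r * r = t by rewrite -expr2 sqr_sqrtr// ltW.
have r0 : 0 <= r by exact: sqrtr_ge0.
exists (r%:C *: (e - l)); split.
- split; first by rewrite starZr starB star_unit sl.
  exists r => //; rewrite -scalerBr opprB addrC subrK nrZr ger0_norm//.
  by rewrite ler_piMr.
- rewrite scaler_cmull scaler_cmulr scalerA -rmorphM/= rr.
  have -> : (e - l) ** (e - l) = e - x.
    rewrite xl scaler2C cmulBl !cmulBr !e1l e1r !opprB !opprD !addrA.
    by rewrite [e - l + _]addrAC.
  by rewrite opprB addrC subrK scalerA -rmorphM/= divff ?gt_eqF// scale1r.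
move=> z zh; rewrite scaler_cmulr scaler_cmull cmulBr cmulBl e1l e1r lz//.
by rewrite /x cmulBr cmulBl e1l e1r scaler_cmulr scaler_cmull zh.
Qed.

(** With |k| <= 1 and m = (1 - k^2)^(1/2), the unitary v = m + i k gives
    |1 - 2 k^2| <= 1, as 1 - 2 k^2 is the real part of v^2. *)
Lemma pos_square k : star k = k -> pos (k ** k).
Proof.
move=> sk; split; first by rewrite starM sk.
pose s := nr k + 1; have s0 : 0 < s by rewrite ltr_wpDl ?nr_ge0.
pose k1 := s^-1%:C *: k.
have sk1 : star k1 = k1 by rewrite starZr sk.
have nk1 : nr k1 <= 1.
  by rewrite nrZr ger0_norm ?invr_ge0 ?(ltW s0)// mulrC ler_pdivrMr// mul1r lerDl.
have kkE : k ** k = (s ^+ 2)%:C *: (k1 ** k1).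
  rewrite /k1 scaler_cmull scaler_cmulr !scalerA -!rmorphM/=.
  rewrite [X in X%:C *: _](_ : _ = 1) ?scale1r//; field; exact: lt0r_neq0.
clearbody k1.
have [|m [[sm _] mm mz]] := @pos_sqrt (e - k1 ** k1).
  split; first by rewrite starB star_unit starM sk1.
  exists 1; rewrite // scale1r opprB addrC subrK.
  by rewrite (le_trans (nr_cmul _ _))// mulr_ile1 ?nr_ge0.
have km : k1 ** m = m ** k1.
  by apply: mz; rewrite cmulBr cmulBl e1l e1r cmulA.
pose v := m + 'i%C *: k1.
have sv : star v = m - 'i%C *: k1 by rewrite starD starZ sm sk1 conj_i scaleNr.
have vv : star v ** v = e.
  rewrite sv /v cmulBl !cmulDr !scaler_cmull !scaler_cmulr km scalerA.
  rewrite -expr2 sqr_i scaleN1r opprD opprK addrA addrK mm.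
  by rewrite subrK.
have nv : nr v <= 1.
  rewrite -(@ler_pXn2r _ 2)// ?nnegrE ?nr_ge0//.
  by rewrite -nr_starM vv expr1n nr_unit_le1.
have re : v ** v + star v ** star v = 2%:C *: (e - 2%:C *: (k1 ** k1)).
  rewrite sv /v !cmulDl !cmulDr !cmulNr !cmulrN !scaler_cmull !scaler_cmulr km.
  rewrite scalerA -expr2 sqr_i !scaleN1r mm !opprK.
  rewrite addrACA [X in X + _]addrACA [X in _ + X]addrACA !subrr addr0 add0r.
  by rewrite addrACA -scaler2C -addrA -opprD -scaler2C.
have h2 : nr (2%:C *: (e - 2%:C *: (k1 ** k1))) <= 2.
  rewrite -re (le_trans (nrD _ _))//.
  have := nr_cmul v v; have := nr_cmul (star v) (star v); rewrite nr_star.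
  have := nr_ge0 v; nra.
exists (2^-1 * s ^+ 2); first by rewrite mulr_ge0 ?sqr_ge0.
have -> : (2^-1 * s ^+ 2)%:C *: e - k ** k =
    (s ^+ 2 * 4^-1)%:C *: (2%:C *: (e - 2%:C *: (k1 ** k1))).
  rewrite kkE !scalerBr !scalerA -!rmorphM/=.
  by congr (_%:C *: _ - _%:C *: _); field.
rewrite nrZr ger0_norm; last by rewrite mulr_ge0 ?sqr_ge0.
have : 0 <= s ^+ 2 by exact: sqr_ge0.
by nra.
Qed.

(** The roots k of h and l of r - h commute and k^2 + l^2 = r. *)
Lemma pos_le_scalar h r : 0 <= r -> pos h -> pos (r%:C *: e - h) -> nr h <= r.
Proof.
move=> r0 /pos_sqrt[k [[sk _] kk kz]] /pos_sqrt[l [[sl _] ll lz]].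
have kl : k ** l = l ** k.
  apply: lz; rewrite cmulBr cmulBl scaler_cmulr scaler_cmull e1l e1r.
  by rewrite -kk cmulA.
have -> : nr h = nr k ^+ 2 by rewrite -kk -nr_starM sk.
by apply: (nr_le_of_squares r0 sk sl kl); rewrite kk ll addrC subrK.
Qed.

(** Here a <= b <= |b|. *)
Lemma pos_nr_mono a b : pos a -> pos (b - a) -> nr a <= nr b.
Proof.
move=> pa pba; apply: pos_le_scalar => //; first exact: nr_ge0.
have sb : star b = b.
  by rewrite -(subrK a b) starD (pos_star pa) (pos_star pba).
by rewrite -(subrKA b); exact: posD (pos_nr sb) pba.
Qed.

(** y y* is positive because y y* + y* y is a sum of squares.  With
    P = y y* and N = - y* y, the norm of t N + N^2 = - y* (t - P) y is at most
    t |N| for large t, which is too small for a positive N unless N = 0. *)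
Lemma pos_starM_opp y : pos (- (star y ** y)) -> y = 0.
Proof.
set N := - _ => pN.
have yyN : star y ** y = - N by rewrite opprK.
have pP : pos (y ** star y).
  pose a := y + star y; pose b := 'i%C *: (y - star y).
  have sa : star a = a by rewrite starD starK addrC.
  have sb : star b = b by rewrite starZ starB starK conj_i scaleNr -scalerN opprB.
  have -> : y ** star y = 2^-1%:C *: (a ** a + b ** b) + N.
    rewrite /N /a /b scaler_cmull scaler_cmulr scalerA -expr2 sqr_i scaleN1r.
    set s := star y; rewrite !cmulDl !cmulDr !cmulNr !cmulrN opprK !opprD !opprK.
    rewrite addrACA [- (y ** y) + _]addrC [X in _ *: (X + _)]addrC subrKA.
    rewrite [X in _ *: (_ + X)]addrACA subrr addr0.
    rewrite addrACA -scaler2C scalerA -rmorphM/= mulVf// scale1r.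
    by rewrite addrK.
  apply: posD => //; apply: posZ; first by rewrite invr_ge0.
  by apply: posD; exact: pos_square.
have [sP [t t0 tP]] := pP.
have nN : nr N = nr y ^+ 2 by rewrite nrN nr_starM.
have h1 : nr (t%:C *: N + N ** N) <= t * nr N.
  have -> : t%:C *: N + N ** N = - (star y ** (t%:C *: e - y ** star y) ** y).
    rewrite cmulBr cmulBl scaler_cmulr scaler_cmull e1r cmulA yyN.
    by rewrite -cmulA yyN cmulrN cmulNr opprK scalerN opprB opprK addrC.
  rewrite nrN (le_trans (nr_cmul _ _))// (le_trans (ler_wpM2r _ (nr_cmul _ _))) ?nr_ge0//.
  rewrite nr_star nN; have := nr_ge0 y.
  by move=> y0; rewrite mulrAC -expr2 mulrC ler_wpM2r// sqr_ge0.
(* Completing the square, w^2 = t N + N^2 + t^2 / 4. *)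
pose w := N + (t / 2)%:C *: e.
have sN := pos_star pN.
have sw : star w = w by rewrite starD scalar_star sN.
have h2 : nr w ^+ 2 <= t * nr N + t ^+ 2 / 4.
  rewrite -nr_starM sw.
  have -> : w ** w = t%:C *: N + N ** N + (t ^+ 2 / 4)%:C *: e.
    rewrite /w cmulDl !cmulDr !scaler_cmull !scaler_cmulr e1l e1l e1r scalerA.
    rewrite addrA -[X in X + _ = _]addrA -scalerDl -rmorphD/= -splitr.
    rewrite [N ** N + _]addrC; congr (_ + _ *: _).
    by rewrite -rmorphM; congr (_%:C); field.
  rewrite (le_trans (nrD _ _))// lerD// (le_trans (nr_scalar _))// ger0_norm//.
  by rewrite divr_ge0 ?sqr_ge0.
(* From w <= |w|; the maximum with 0 makes the upper bound a positive scalar. *)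
have h3 : nr N <= Num.max 0 (nr w - t / 2).
  apply: pos_le_scalar => //; first by rewrite le_max lexx.
  have -> : (Num.max 0 (nr w - t / 2))%:C *: e - N =
     (Num.max 0 (nr w - t / 2) - (nr w - t / 2))%:C *: e + ((nr w)%:C *: e - w).
    rewrite /w rmorphB scalerBl -addrA; congr (_ + _).
    rewrite rmorphB scalerBl opprB subrKA [N + _]addrC opprD addrA.
    by rewrite subrr add0r.
  apply: posD (pos_nr sw); apply: pos_scalar.
  by rewrite subr_ge0 le_max lexx orbT.
have N0 : nr N = 0.
  apply/eqP; rewrite eq_le nr_ge0 andbT.
  have [//|wt] := leP (nr N) 0.
  have h4 : nr N <= nr w - t / 2.
    by move: h3; rewrite le_max leNgt wt.
  by have := nr_ge0 N; nra.
by apply/starM_eq0/nr_eq0; rewrite nr_starM -nN N0.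
Qed.

(** For h = x* x with |h| = (h^2)^(1/2) and negative part q = (|h| - h)/2, the
    element y = x q satisfies y* y = - |h| q^2, the negative of a square, so
    it vanishes; hence q = 0 and h = |h|. *)
Theorem pos_starM x : pos (star x ** x).
Proof.
set h := _ ** _.
have sh : star h = h by rewrite starM starK.
have [g [pg gg gz]] := pos_sqrt (pos_square sh).
have sg := pos_star pg.
have hg : h ** g = g ** h by apply: gz; rewrite cmulA.
have [m [[sm _] mm mz]] := pos_sqrt pg.
have hm : h ** m = m ** h by exact: mz.
have gm : g ** m = m ** g by exact: mz.
pose q := g - h.
have sq : star q = q by rewrite starB sg sh.
have mq : m ** q = q ** m by rewrite cmulBr cmulBl hm gm.
have hq : h ** q = - (g ** q).
  by rewrite !cmulBr hg gg opprB.
have qq : q ** q = 2%:C *: (g ** q).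
  by rewrite [LHS]cmulBl hq opprK -scaler2C.
have y0 : x ** q = 0.
  apply: pos_starM_opp.
  have -> : - (star (x ** q) ** (x ** q)) = (m ** q) ** (m ** q).
    rewrite starM sq -cmulA [star x ** _]cmulA -/h hq cmulrN opprK.
    by rewrite -mm mq -!cmulA; congr (_ ** _); rewrite mq cmulA.
  by apply: pos_square; rewrite starM sq sm mq.
have gq0 : g ** q = 0.
  suff mq0 : m ** q = 0 by rewrite -mm -cmulA mq0 cmulr0.
  apply: starM_eq0; rewrite starM sq sm.
  have : star (x ** q) ** (x ** q) = 0 by rewrite y0 cmulr0.
  rewrite starM sq -cmulA [star x ** _]cmulA -/h hq cmulrN => /eqP.
  by rewrite oppr_eq0 => /eqP; rewrite -mm !cmulA.
have q0 : q = 0 by apply: starM_eq0; rewrite sq qq gq0 scaler0.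
by rewrite -[h](subrKC g) -opprB -/q q0 subr0.
Qed.

Lemma pos_conj h x : pos h -> pos (star x ** h ** x).
Proof.
move=> /pos_sqrt[k [[sk _] <- _]].
rewrite cmulA -cmulA -[in X in X ** _]sk -starM.
exact: pos_starM.
Qed.

End Positivity.

(** * Homomorphisms *)

Section StarHom.
Variables (R : realType) (A B : cstarType R) (f : A -> B).
Hypothesis hf : star_hom f.

Lemma homD x y : f (x + y) = f x + f y.
Proof. by have := star_hom_linear hf 1 x y; rewrite !scale1r. Qed.

Lemma hom0 : f 0 = 0.
Proof. by apply: (addrI (f 0)); rewrite -homD !addr0. Qed.

Lemma homZ a x : f (a *: x) = a *: f x.
Proof. by have := star_hom_linear hf a x 0; rewrite !addr0 hom0 addr0. Qed.

Lemma homB x y : f (x - y) = f x - f y.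
Proof. by rewrite -scaleN1r homD homZ scaleN1r. Qed.

Lemma homM x y : f (x ** y) = f x ** f y.
Proof. exact: star_hom_mul. Qed.

Lemma hom_star x : f (star x) = star (f x).
Proof. exact: star_hom_star. Qed.

End StarHom.

Lemma star_hom_comp (R : realType) (A B C : cstarType R) (g : B -> C) (f : A -> B) :
  star_hom g -> star_hom f -> star_hom (g \o f).
Proof.
move=> hg hf; split=> [a x y|x y|x] /=.
- by rewrite (homD hf) (homZ hf) (homD hg) (homZ hg).
- by rewrite (homM hf) (homM hg).
by rewrite (hom_star hf) (hom_star hg).
Qed.

(** * Left multiplication, and positivity without a unit *)

Section LeftMultiplication.
Variables (R : realType) (D : cstarType R).

Definition regular_module : hilbert_module D.
Proof.
refine (@HilbertModule R D D (fun x y => star x ** y) _ _ _ _ _).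
- by move=> x y z; rewrite cmulDr.
- by move=> a x y; rewrite scaler_cmulr.
- by move=> x y; rewrite starM starK.
- by move=> x; rewrite nr_starM.
- by move=> x y; rewrite (le_trans (nr_cmul _ _))// nr_star.
Defined.

Local Notation U := (adj regular_module).

Lemma lmul_adjointable (a : D) :
  @adjointable R D regular_module (fun x : D => a ** x).
Proof.
exists (fun x : D => star a ** x); split => [x y|] /=.
  by rewrite starM cmulA.
exists (nr a) => x; split; first exact: (@nr_cmul R D a x).
by rewrite -(nr_star a); exact: (@nr_cmul R D (star a) x).
Qed.

Definition lmul a : U := mk_adj (lmul_adjointable a).

Lemma lmulE a (x : D) : lmul a x = a ** x. Proof. by []. Qed.

Lemma lmul_hom : star_hom lmul.
Proof.
split=> [a x y|x y|x].
- apply: adj_ext => z; change ((a *: x + y) ** z = a *: (x ** z) + y ** z).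
  by rewrite cmulDl scaler_cmull.
- by apply: adj_ext => z; change (x ** y ** z = x ** (y ** z)); rewrite cmulA.
by symmetry; apply: starP => y z /=; rewrite starM cmulA.
Qed.

Lemma nr_lmul a : nr (lmul a) = nr a.
Proof.
apply/eqP; rewrite eq_le; apply/andP; split.
  by apply: nr_adj_le => [|x]; [exact: nr_ge0|exact: (@nr_cmul R D a x)].
have [->|a0] := eqVneq (nr a) 0; first exact: nr_ge0.
have na0 : 0 < nr a by rewrite lt_def a0 nr_ge0.
rewrite -(ler_pM2r na0) -expr2 -nr_Mstar -[X in _ * X]nr_star.
exact: (nr_adj_app (lmul a) (star a)).
Qed.

Lemma lmul_adj (m : U) (x : D) : lmul (m x) = m ** lmul x.
Proof.
apply: adj_ext => y; rewrite adj_mulE !lmulE; apply: (@ip_inj _ _ regular_module) => z.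
by rewrite ip_star /= !starM -!cmulA; congr (_ ** _); exact: (ip_star m x z).
Qed.

(** Left multiplication embeds D isometrically in a unital algebra. *)
Definition dpos (d : D) : Prop := pos (adj_one regular_module) (lmul d).

Let e1l (x : U) : adj_one regular_module ** x = x. Proof. exact: adj1l. Qed.
Let e1r (x : U) : x ** adj_one regular_module = x. Proof. exact: adj1r. Qed.

Lemma dpos_starM x : dpos (star x ** x).
Proof.
by rewrite /dpos (homM lmul_hom) (hom_star lmul_hom); exact: pos_starM.
Qed.

Lemma dposD a b : dpos a -> dpos b -> dpos (a + b).
Proof. by rewrite /dpos (homD lmul_hom); exact: posD. Qed.

Lemma dposZ (r : R) a : 0 <= r -> dpos a -> dpos (r%:C *: a).
Proof. by rewrite /dpos (homZ lmul_hom); exact: posZ. Qed.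

Lemma dpos0 : dpos 0.
Proof. by rewrite /dpos (hom0 lmul_hom); exact: pos0. Qed.

Lemma dpos_sum (I : Type) (s : seq I) (P : pred I) (F : I -> D) :
  (forall i, P i -> dpos (F i)) -> dpos (\sum_(i <- s | P i) F i).
Proof. by move=> h; apply: big_ind => //; [exact: dpos0|exact: dposD]. Qed.

Lemma dpos_nr_mono a b : dpos a -> dpos (b - a) -> nr a <= nr b.
Proof.
rewrite /dpos -(nr_lmul a) -(nr_lmul b) (homB lmul_hom).
by apply: pos_nr_mono.
Qed.

(** For squares this is |x* x| <= |x* x + y* y|, by which the finite partial sums
    of <x, x> increase in norm. *)
Lemma dpos_nr_le_add a b : dpos a -> dpos b -> nr a <= nr (a + b).
Proof. by move=> pa pb; apply: dpos_nr_mono; rewrite // addrC addKr. Qed.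

Lemma dpos_conj (r : R) d x : star d = d -> nr d <= r ->
  dpos (r%:C *: (star x ** x) - star x ** d ** x).
Proof.
move=> sd dr.
have : pos (adj_one regular_module) (r%:C *: adj_one regular_module - lmul d).
  rewrite -(subrKA ((nr d)%:C *: adj_one regular_module)) -scalerBl -rmorphB/=.
  apply: posD => //; first by apply: (pos_scalar e1r); rewrite subr_ge0.
  rewrite -nr_lmul; apply: (pos_nr e1r).
  by rewrite -(hom_star lmul_hom) sd.
move/(pos_conj e1l e1r (lmul x)).
rewrite cmulBr cmulBl scaler_cmulr scaler_cmull e1r -(hom_star lmul_hom).
by rewrite -!(homM lmul_hom) -(homZ lmul_hom) -(homB lmul_hom).
Qed.

(** The difference is x* (r^2 - m* m) x. *)
Lemma dpos_adj (m : U) (r : R) x : nr m <= r ->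
  dpos ((r ^+ 2)%:C *: (star x ** x) - star (m x : D) ** m x).
Proof.
move=> mr; have r0 : 0 <= r by rewrite (le_trans _ mr)// nr_ge0.
have : pos (adj_one regular_module) ((r ^+ 2)%:C *: adj_one regular_module - star m ** m).
  rewrite -(subrKA ((nr (star m ** m))%:C *: adj_one regular_module)) -scalerBl -rmorphB/=.
  apply: posD => //.
    apply: (pos_scalar e1r).
    by rewrite subr_ge0 nr_starM lerXn2r// nnegrE nr_ge0.
  by apply: (pos_nr e1r); rewrite starM starK.
move/(pos_conj e1l e1r (lmul x)).
have -> : star (lmul x) ** ((r ^+ 2)%:C *: adj_one regular_module - star m ** m)
    ** lmul x = lmul ((r ^+ 2)%:C *: (star x ** x) - star (m x : D) ** m x).
  rewrite (homB lmul_hom) (homZ lmul_hom) !(homM lmul_hom) !(hom_star lmul_hom).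
  by rewrite lmul_adj starM cmulBr cmulBl scaler_cmulr scaler_cmull e1r !cmulA.
by [].
Qed.

End LeftMultiplication.

(** For self-adjoint a with |a| <= 1, let l in A solve a^2 = 2 l - l^2.  Then
    f(a)^2 + (1 - f(l))^2 = 1 in the algebra of left multiplications of B, so
    |f(a)| <= 1. *)
Lemma star_hom_le (R : realType) (A B : cstarType R) (f : A -> B) :
  star_hom f -> forall a, nr (f a) <= nr a.
Proof.
move=> hf; pose H := regular_module B; pose e := adj_one H.
have e1l (x : adj H) : e ** x = x by exact: adj1l.
have e1r (x : adj H) : x ** e = x by exact: adj1r.
have lh := @lmul_hom R B.
have unit_ball a : star a = a -> nr a <= 1 -> nr (f a) <= 1.
  move=> sa a1; have h1 : nr (a ** a) <= 1.
    by rewrite (le_trans (nr_cmul _ _))// mulr_ile1 ?nr_ge0.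
  have [l [aE _ sl lz]] := iterated_square_root h1.
  rewrite -(@ler_pXn2r _ 2)// ?nnegrE ?nr_ge0// expr1n -nr_lmul.
  apply: (nr_le_of_squares e1l e1r (m := e - lmul (f l))) => //.
  - by rewrite -(hom_star lh) -(hom_star hf) sa.
  - rewrite starB (star_unit e1r) -(hom_star lh) -(hom_star hf) sl//.
    by rewrite starM sa.
  - rewrite cmulBr cmulBl e1l e1r; congr (_ - _).
    by rewrite -!(homM lh) -!(homM hf) lz// cmulA.
  rewrite scale1r -(homM lh) -(homM hf) aE (homB hf) (homB lh) cmulBl !cmulBr.
  rewrite !e1l e1r scaler2C (homD hf) (homD lh) (homM hf) (homM lh).
  rewrite opprB addrA -[_ - _ + _ + _]addrA.
  by rewrite [_ - _ + (_ - _)]addrC addrA subrKA addrK addrC subrK.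
have sa_le a : star a = a -> nr (f a) <= nr a.
  move=> sa; apply/ler_addgt0Pr => d d0.
  pose r := nr a + d; have r0 : 0 < r by rewrite ltr_wpDl ?nr_ge0.
  have := unit_ball (r^-1%:C *: a); rewrite starZr sa (homZ hf) !nrZr.
  rewrite ger0_norm ?invr_ge0 ?(ltW r0)// ![r^-1 * _]mulrC !ler_pdivrMr// !mul1r.
  by apply => //; rewrite lerDl ltW.
move=> a; rewrite -(@ler_pXn2r _ 2)// ?nnegrE ?nr_ge0//.
rewrite -!nr_starM -(hom_star hf) -(homM hf).
by apply: sa_le; rewrite starM starK.
Qed.

Lemma star_hom_le_sub (R : realType) (A B : cstarType R) (f : A -> B) :
  star_hom f -> forall a b, nr (f a - f b) <= nr (a - b).
Proof. by move=> hf a b; rewrite -(homB hf) star_hom_le. Qed.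

(** * Square-summable families *)

Section Gram.
Variables (R : realType) (D : cstarType R) (I : choiceType).
Implicit Types (s : seq I) (x y : I -> D) (F : {fset I}).

Definition gram s x y : D := \sum_(i <- s) star (x i) ** y i.

Lemma gramDr s x y z : gram s x (y + z) = gram s x y + gram s x z.
Proof. by rewrite /gram -big_split/=; apply: eq_bigr => i _; rewrite cmulDr. Qed.

Lemma gramZr s a x y : gram s x (a *: y) = a *: gram s x y.
Proof. by rewrite /gram scaler_sumr; apply: eq_bigr => i _; rewrite scaler_cmulr. Qed.

Lemma star_gram s x y : star (gram s x y) = gram s y x.
Proof. by rewrite star_sum; apply: eq_bigr => i _; rewrite starM starK. Qed.

Lemma gramDl s x y z : gram s (x + y) z = gram s x z + gram s y z.
Proof. by rewrite -star_gram gramDr starD !star_gram. Qed.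

Lemma gramZlr s (r : R) x y : gram s (r%:C *: x) y = r%:C *: gram s x y.
Proof. by rewrite -star_gram gramZr starZr star_gram. Qed.

Lemma dpos_gram s x : dpos (gram s x x).
Proof. by apply: dpos_sum => i _; exact: dpos_starM. Qed.

(** With c = <x, y>, N >= |<x, x>| and b = c / N, the element
    <y - x b, y - x b> is positive and at most <y, y> - c* c / N. *)
Lemma gram_cauchy_schwarz_bound s x y (N : R) : 0 < N -> nr (gram s x x) <= N ->
  nr (gram s x y) ^+ 2 <= N * nr (gram s y y).
Proof.
move=> N0 pN; set c := gram s x y.
pose r := N^-1; have r0 : 0 <= r by rewrite invr_ge0 ltW.
rewrite -ler_pdivrMl// -nr_starM -[N^-1]ger0_norm// -nrZr.
apply: dpos_nr_mono; first by apply: dposZ => //; exact: dpos_starM.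
pose z i := y i - r%:C *: (x i ** c).
have zz : gram s z z = gram s y y - r%:C *: (star c ** c) - r%:C *: (star c ** c)
    + (r ^+ 2)%:C *: (star c ** gram s x x ** c).
  pose u i := x i ** c; have -> : z = y + (- r)%:C *: u.
    by apply/funext => i; rewrite /z rmorphN/= scaleNr.
  have gu w : gram s w u = gram s w x ** c.
    by rewrite cmul_suml; apply: eq_bigr => i _; rewrite cmulA.
  have ug w : gram s u w = star c ** gram s x w.
    by rewrite -star_gram gu starM star_gram.
  rewrite gramDr !gramDl !gramZr !gramZlr !gu !ug -(star_gram s x y) -/c.
  rewrite addrA scalerA -rmorphM/= mulrNN -expr2.
  by rewrite rmorphN/= !scaleNr.
have -> : gram s y y - r%:C *: (star c ** c) = gram s z z +
    (r ^+ 2)%:C *: (N%:C *: (star c ** c) - star c ** gram s x x ** c).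
  rewrite zz scalerBr scalerA -rmorphM/= addrACA subrr addr0.
  have -> : r ^+ 2 * N = r by rewrite expr2 -mulrA mulVf ?gt_eqF// mulr1.
  by rewrite subrK.
apply: dposD; first exact: dpos_gram.
by apply: dposZ; [exact: sqr_ge0|apply: dpos_conj => //; rewrite star_gram].
Qed.

Definition semi s x : R := Num.sqrt (nr (gram s x x)).

Lemma semi_ge0 s x : 0 <= semi s x. Proof. exact: sqrtr_ge0. Qed.

Lemma sqr_semi s x : semi s x ^+ 2 = nr (gram s x x).
Proof. by rewrite sqr_sqrtr// nr_ge0. Qed.

Lemma gram_cauchy_schwarz s x y : nr (gram s x y) <= semi s x * semi s y.
Proof.
rewrite -(@ler_pXn2r _ 2)// ?nnegrE ?mulr_ge0 ?nr_ge0 ?semi_ge0//.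
rewrite exprMn !sqr_semi; apply/ler_addgt0Pr => e e0.
pose d := e / (nr (gram s y y) + 1).
have y1 : 0 < nr (gram s y y) + 1 by rewrite ltr_wpDl ?nr_ge0.
have d0 : 0 < d by rewrite divr_gt0.
have := @gram_cauchy_schwarz_bound s x y (nr (gram s x x) + d).
rewrite ltr_wpDl ?nr_ge0// lerDl (ltW d0) => /(_ isT isT) h.
rewrite (le_trans h)// mulrDl lerD2l.
have -> : e = d * (nr (gram s y y) + 1) by rewrite /d divfK// gt_eqF.
by rewrite ler_wpM2l ?(ltW d0)// lerDl.
Qed.

Lemma semiD s x y : semi s (x + y) <= semi s x + semi s y.
Proof.
rewrite -(@ler_pXn2r _ 2)// ?nnegrE ?addr_ge0 ?semi_ge0//.
rewrite sqr_semi gramDr !gramDl sqrrD !sqr_semi.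
have h := gram_cauchy_schwarz s x y.
have h' : nr (gram s y x) <= semi s x * semi s y.
  by rewrite mulrC gram_cauchy_schwarz.
have k1 := nrD (gram s x x + gram s y x) (gram s x y + gram s y y).
have k2 := nrD (gram s x x) (gram s y x).
have k3 := nrD (gram s x y) (gram s y y).
rewrite -mulr_natl; lra.
Qed.

Lemma semiZ s (a : R[i]) x : semi s (a *: x) = complex.Re `|a| * semi s x.
Proof.
have a0 : 0 <= complex.Re `|a| by rewrite normc_def/= sqrtr_ge0.
rewrite /semi gramZr -star_gram gramZr starZ star_gram !nrZ norm_conjC mulrA.
by rewrite sqrtrM ?mulr_ge0// -expr2 sqrtr_sqr ger0_norm.
Qed.

Lemma semi0 s : semi s 0 = 0.
Proof. by rewrite /semi [gram _ _ _]big1 ?nr0 ?sqrtr0// => i _; rewrite cmulr0. Qed.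

Lemma semiN s x : semi s (- x) = semi s x.
Proof. by rewrite -scaleN1r semiZ normrN1 mul1r. Qed.

Lemma semi_trans s z x y : semi s (x - y) <= semi s (x - z) + semi s (z - y).
Proof. by rewrite -[x - y](subrKA z) semiD. Qed.

Lemma semi_cat s1 s2 x : semi (s1 ++ s2) x <= semi s1 x + semi s2 x.
Proof.
rewrite -(@ler_pXn2r _ 2)// ?nnegrE ?addr_ge0 ?semi_ge0//.
rewrite sqr_semi sqrrD !sqr_semi /gram big_cat/=.
rewrite (le_trans (nrD _ _))// addrAC lerDl mulrn_wge0// mulr_ge0 ?semi_ge0//.
Qed.

Lemma semi1 i x : semi [:: i] x = nr (x i).
Proof. by rewrite /semi /gram big_seq1 nr_starM sqrtr_sqr ger0_norm ?nr_ge0. Qed.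

Lemma perm_semi s1 s2 x : perm_eq s1 s2 -> semi s1 x = semi s2 x.
Proof. by move=> p; rewrite /semi /gram (perm_big _ p). Qed.

Lemma gram_fsetD F1 F2 x y : (F1 `<=` F2)%fset ->
  gram F2 x y = gram F1 x y + gram (F2 `\` F1)%fset x y.
Proof.
move=> F12; rewrite /gram -big_cat; apply: perm_big.
apply: uniq_perm; rewrite ?fset_uniq// ?cat_uniq ?fset_uniq ?andbT//=.
  by apply/hasPn => i; rewrite inE => /andP[].
move=> i; rewrite mem_cat in_fsetD; case: (boolP (i \in F1)) => //= iF.
by rewrite (fsubsetP F12).
Qed.

Lemma semi_fsubset F1 F2 x : (F1 `<=` F2)%fset -> semi F1 x <= semi F2 x.
Proof.
move=> F12; rewrite /semi ler_sqrt ?nr_ge0// (gram_fsetD _ _ F12).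
by apply: dpos_nr_le_add; exact: dpos_gram.
Qed.

End Gram.

Section Ell2.
Variables (R : realType) (D : cstarType R) (I : choiceType).
Implicit Types (x y : I -> D) (F : {fset I}).

(** Smallness of the tails, rather than boundedness of the finite sums, makes
    the inner products converge in norm. *)
Definition square_summable x : Prop := forall e : R, 0 < e ->
  exists F0 : {fset I}, forall F, [disjoint F0 & F]%fset -> semi F x <= e.

Definition ell2_pred : {pred I -> D} := fun x => `[< square_summable x >].

Lemma ell2_submod : submod_closed ell2_pred.
Proof.
split=> [|a x y /asboolP hx /asboolP hy]; apply/asboolP => e e0.
  by exists fset0 => F _; rewrite semi0 ltW.
have a0 : 0 <= complex.Re `|a| by rewrite normc_def/= sqrtr_ge0.
pose d := e / (complex.Re `|a| + 1).
have a1 : 0 < complex.Re `|a| + 1 by rewrite ltr_wpDl.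
have d0 : 0 < d by rewrite divr_gt0.
have [F1 h1] := hx d d0; have [F2 h2] := hy d d0.
exists (F1 `|` F2)%fset => F; rewrite fdisjointUX => /andP[f1 f2].
rewrite (le_trans (semiD _ _ _))// semiZ.
have -> : e = complex.Re `|a| * d + d.
  by rewrite -[X in _ + X]mul1r -mulrDl mulrC /d divfK// gt_eqF.
by rewrite lerD ?h2// ler_wpM2l// h1.
Qed.

HB.instance Definition _ :=
  GRing.isSubmodClosed.Build _ _ ell2_pred ell2_submod.

Record ell2 := Ell2 { ell2_fun :> I -> D; ell2_subproof : ell2_fun \in ell2_pred }.

HB.instance Definition _ := [isSub for ell2_fun].
HB.instance Definition _ := [Choice of ell2 by <:].
HB.instance Definition _ := [SubChoice_isSubLmodule of ell2 by <:].

Implicit Types (u v w : ell2).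

Lemma ell2P u : square_summable u.
Proof. by case: u => x xP /=; apply/asboolP; exact: xP. Qed.

Definition mk_ell2 x (hx : square_summable x) : ell2 := Ell2 (asboolT hx).

Lemma ell2_ext u v : (forall i, u i = v i) -> u = v.
Proof. by move=> uv; apply/val_inj/funext. Qed.

Lemma ell2_addE u v i : (u + v) i = u i + v i. Proof. by []. Qed.
Lemma ell2_scaleE a u i : (a *: u) i = a *: u i. Proof. by []. Qed.

Definition ell2_nr u : R := sup [set semi F u | F in [set: {fset I}]].

Let semis_nonempty u : [set semi F u | F in [set: {fset I}]] !=set0.
Proof. by exists (semi (fset0 : {fset I}) u), fset0. Qed.

Let semis_has_ub u : has_ubound [set semi F u | F in [set: {fset I}]].
Proof.
have [F0 h0] := ell2P u ltr01; exists (semi F0 u + 1) => _ [F _ <-].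
rewrite (@le_trans _ _ (semi (F0 `|` F)%fset u))//.
  by apply: semi_fsubset; rewrite fsubsetUr.
have p : perm_eq (F0 `|` F)%fset (F0 ++ (F `\` F0)%fset).
  apply: uniq_perm; rewrite ?fset_uniq// ?cat_uniq ?fset_uniq ?andbT//=.
    by apply/hasPn => i; rewrite inE => /andP[].
  by move=> i; rewrite mem_cat in_fsetD in_fsetU; case: (i \in F0).
rewrite (perm_semi _ p) (le_trans (semi_cat _ _ _))// lerD2l h0//.
by apply/fdisjointP => i iF; rewrite in_fsetD iF.
Qed.

Lemma semi_le_ell2 F u : semi F u <= ell2_nr u.
Proof. by apply: ub_le_sup; [exact: semis_has_ub|exists F]. Qed.

Lemma ell2_nr_le u (K : R) : (forall F, semi F u <= K) -> ell2_nr u <= K.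
Proof. by move=> h; apply: ge_sup; [exact: semis_nonempty|move=> _ [F _ <-]]. Qed.

Lemma ell2_nr_ge0 u : 0 <= ell2_nr u.
Proof. by rewrite (le_trans (semi_ge0 fset0 u))// semi_le_ell2. Qed.

Lemma coord_le_ell2 u i : nr (u i) <= ell2_nr u.
Proof.
rewrite -semi1 -(@perm_semi _ _ _ [fset i]%fset) ?semi_le_ell2//.
by apply: uniq_perm; rewrite ?fset_uniq// => j; rewrite !inE.
Qed.

Definition ell2_norm u : R[i] := (ell2_nr u)%:C.

Lemma ell2_normD u v : ell2_norm (u + v) <= ell2_norm u + ell2_norm v.
Proof.
rewrite -rmorphD lecR; apply: ell2_nr_le => F.
by rewrite (le_trans (semiD _ _ _))// lerD// semi_le_ell2.
Qed.

Lemma ell2_normZ (a : R[i]) u : ell2_norm (a *: u) = `|a| * ell2_norm u.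
Proof.
have aE : `|a| = (complex.Re `|a|)%:C by rewrite normc_def.
have a0 : 0 <= complex.Re `|a| by rewrite normc_def/= sqrtr_ge0.
rewrite aE -rmorphM; congr (_%:C); apply/eqP; rewrite eq_le; apply/andP; split.
  by apply: ell2_nr_le => F; rewrite semiZ ler_wpM2l// semi_le_ell2.
have [z|z] := eqVneq (complex.Re `|a|) 0; first by rewrite z mul0r ell2_nr_ge0.
have zp : 0 < complex.Re `|a| by rewrite lt_def z.
rewrite -ler_pdivlMl//; apply: ell2_nr_le => F.
by rewrite ler_pdivlMl// -semiZ; exact: (semi_le_ell2 F (a *: u)).
Qed.

Lemma ell2_norm0_eq0 u : ell2_norm u = 0 -> u = 0.
Proof.
case=> u0; apply: ell2_ext => i; apply/nr_eq0/eqP.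
by rewrite eq_le nr_ge0 (le_trans (coord_le_ell2 _ _))// u0.
Qed.

HB.instance Definition _ := Lmodule_isNormed.Build R[i] ell2
  ell2_normD ell2_normZ ell2_norm0_eq0.

Lemma nr_ell2 u : nr u = ell2_nr u. Proof. by []. Qed.

Lemma nr_coord u i : nr (u i) <= nr u. Proof. exact: coord_le_ell2. Qed.

(** Coordinates converge; the bounds on finite sums are uniform, so they pass to
    the limit family. *)
Lemma ell2_complete (F : set_system ell2) : ProperFilter F -> cauchy F -> cvg F.
Proof.
move=> FF /cauchy_nrP Fc.
have lim1 i : exists l, (u i) @[u --> F] --> (l : D).
  apply: (lipschitz_limit (K := 1) FF Fc) => u v.
  by rewrite mul1r; exact: (nr_coord (u - v) i).
pose l i := sval (cid (lim1 i)).
have lP i : (u i) @[u --> F] --> l i by rewrite /l; case: cid.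
have near_l (s : seq I) e : 0 < e -> F [set u | semi s (ell2_fun u - l) <= e].
  elim: s e => [|i s IH] e e0.
    by apply: filterE => u; rewrite /= /semi /gram big_nil nr0 sqrtr0 ltW.
  have e2 : 0 < e / 2 by rewrite divr_gt0.
  have /cvg_nrP/(_ _ e2) hi := lP i.
  apply: filterS (filterI (IH _ e2) hi) => u /= [h1 h2].
  rewrite -cat1s (le_trans (semi_cat _ _ _))// semi1 nrBC; lra.
have unif e : 0 < e -> exists u : ell2,
    F [set v | nr (u - v) < e] /\ forall s : {fset I}, semi s (ell2_fun u - l) <= e.
  move=> e0; have e2 : 0 < e / 2 by rewrite divr_gt0.
  have [u Fu] := Fc _ e2; exists u; split.
    by apply: filterS Fu => v /= h; lra.
  move=> s; have [v /= [h1 h2]] := filter_ex (filterI Fu (near_l s _ e2)).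
  rewrite (le_trans (semi_trans s v _ _))//.
  have := semi_le_ell2 s (u - v); rewrite -nr_ell2.
  by move: h1 h2 => /ltW; lra.
have hl : square_summable l.
  move=> e e0; have e2 : 0 < e / 2 by rewrite divr_gt0.
  have [u [_ ul]] := unif _ e2; have [F0 h0] := ell2P u e2.
  exists F0 => s /h0 h.
  have := semiD s (ell2_fun u) (- (ell2_fun u - l)).
  rewrite semiN subKr => /le_trans; apply.
  by have := ul s; lra.
apply/cvg_ex; exists (mk_ell2 hl); apply/cvg_nrP => e e0.
have e2 : 0 < e / 3 by rewrite divr_gt0.
have [u [Fu ul]] := unif _ e2.
apply: filterS Fu => v /= uv.
rewrite (le_lt_trans (nr_trans u _ _))//.
have : nr (mk_ell2 hl - u) <= e / 3.
  by rewrite nrBC; apply: ell2_nr_le => s; exact: ul.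
lra.
Qed.

HB.instance Definition _ := Uniform_isComplete.Build ell2 ell2_complete.

End Ell2.

(** * The Hilbert module of square-summable families *)

Section Ell2Module.
Variables (R : realType) (D : cstarType R) (I : choiceType).
Implicit Types (u v w : ell2 D I) (F : {fset I}).

Local Notation totally := (@summability.totally I).

Lemma gram_tail u v (e : R) : 0 < e -> exists F0 : {fset I}, forall F,
  (F0 `<=` F)%fset -> nr (gram F0 u v - gram F u v) < e.
Proof.
move=> e0; pose d := e / (nr v + 1).
have v1 : 0 < nr v + 1 by rewrite ltr_wpDl ?nr_ge0.
have d0 : 0 < d by rewrite divr_gt0.
have [F0 h0] := ell2P u d0; exists F0 => F F0F.
rewrite (gram_fsetD _ _ F0F) opprD addrA subrr add0r nrN.
rewrite (le_lt_trans (gram_cauchy_schwarz _ _ _))//.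
have -> : e = d * (nr v + 1) by rewrite /d divfK// gt_eqF.
have h1 : semi (F `\` F0)%fset u <= d.
  by apply: h0; apply/fdisjointP => i iF; rewrite in_fsetD iF.
have h2 : semi (F `\` F0)%fset v <= nr v by exact: semi_le_ell2.
rewrite mulrDr mulr1 (le_lt_trans (ler_pM _ _ h1 h2)) ?semi_ge0//.
by rewrite ltrDl.
Qed.

Definition gram_net u v F : D := gram F u v.

Lemma gram_cvg u v : exists l : D, gram_net u v @ totally --> l.
Proof.
suff : cvg (gram_net u v @ totally) by move/cvg_ex.
apply: cauchy_cvg; apply/cauchy_nrP => e e0.
by have [F0 h0] := gram_tail u v e0; exists (gram F0 u v); exists F0.
Qed.

Definition ell2_ip u v : D := sval (cid (gram_cvg u v)).

Lemma cvg_ell2_ip u v : gram_net u v @ totally --> ell2_ip u v.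
Proof. by rewrite /ell2_ip; case: cid. Qed.

Arguments cvg_ell2_ip : clear implicits.

Lemma ell2_ipE u v (l : D) : gram_net u v @ totally --> l -> ell2_ip u v = l.
Proof. by move=> h; exact: (nr_cvg_unique _ (cvg_ell2_ip u v) h). Qed.

Lemma ell2_ipDr u v w : ell2_ip u (v + w) = ell2_ip u v + ell2_ip u w.
Proof.
apply: ell2_ipE.
rewrite (_ : gram_net u (v + w) = gram_net u v + gram_net u w); last first.
  by apply/funext => F; exact: gramDr.
by apply: cvgD; exact: cvg_ell2_ip.
Qed.

Lemma ell2_ipZr a u v : ell2_ip u (a *: v) = a *: ell2_ip u v.
Proof.
apply: ell2_ipE.
rewrite (_ : gram_net u (a *: v) = a *: gram_net u v); last first.
  by apply/funext => F; exact: gramZr.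
by apply: cvgZr; exact: cvg_ell2_ip.
Qed.

Lemma star_ell2_ip u v : star (ell2_ip u v) = ell2_ip v u.
Proof.
symmetry; apply: ell2_ipE; apply/cvg_nrP => e e0.
have /cvg_nrP/(_ e e0) := cvg_ell2_ip u v; apply: filterS => F /=.
by rewrite /gram_net -(star_gram F u v) -starB nr_star.
Qed.

Lemma ell2_ip_cauchy_schwarz u v : nr (ell2_ip u v) <= nr u * nr v.
Proof.
apply: (le_nr_lim _ (cvg_ell2_ip u v)); apply: filterE => F /=.
by rewrite (le_trans (gram_cauchy_schwarz _ _ _))// ler_pM ?semi_ge0//;
   exact: semi_le_ell2.
Qed.

Lemma nr_ell2_ip u : nr (ell2_ip u u) = nr u ^+ 2.
Proof.
apply/eqP; rewrite eq_le expr2 ell2_ip_cauchy_schwarz/= -expr2.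
rewrite -[leRHS]sqr_sqrtr ?nr_ge0// lerXn2r ?nnegrE ?nr_ge0 ?sqrtr_ge0//.
apply: ell2_nr_le => F; rewrite ler_sqrt ?nr_ge0//.
apply/ler_addgt0Pr => e e0.
have /cvg_nrP/(_ e e0)[F0 _ h0] := cvg_ell2_ip u u.
have /= h := h0 _ (fsubsetUl F0 F).
rewrite (@le_trans _ _ (nr (gram (F0 `|` F)%fset u u)))//.
  rewrite (gram_fsetD _ _ (fsubsetUr F0 F)).
  by apply: dpos_nr_le_add; exact: dpos_gram.
have := ler_nrB (gram (F0 `|` F)%fset u u) (ell2_ip u u).
by rewrite nrBC in h; lra.
Qed.

Definition ell2_module : hilbert_module D :=
  HilbertModule ell2_ipDr ell2_ipZr star_ell2_ip nr_ell2_ip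
    ell2_ip_cauchy_schwarz.

Lemma single_summable (i : I) (b : D) : square_summable (fun j => if j == i then b else 0).
Proof.
move=> e e0; exists [fset i]%fset => F; rewrite fdisjoint1X => iF.
rewrite /semi /gram big1_seq ?nr0 ?sqrtr0 ?ltW// => j /= jF.
by have [ji|_] := eqVneq j i; [rewrite -ji jF in iF|rewrite cmulr0].
Qed.

Definition single (i : I) (b : D) : ell2 D I := mk_ell2 (single_summable i b).

Lemma singleE i b j : single i b j = if j == i then b else 0.
Proof. by []. Qed.

Lemma nr_single i b : nr (single i b) <= nr b.
Proof.
apply: ell2_nr_le => F; rewrite /semi /gram.
have [iF|iF] := boolP (i \in F).
  rewrite (big_fsetD1 _ iF)/= eqxx big1_seq ?addr0.
    by rewrite nr_starM sqrtr_sqr ger0_norm ?nr_ge0.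
  by move=> j /=; rewrite !inE => /andP[/negPf -> _]; rewrite cmulr0.
rewrite big1_seq ?nr0 ?sqrtr0 ?nr_ge0// => j /= jF.
by have [ji|_] := eqVneq j i; [rewrite -ji jF in iF|rewrite cmulr0].
Qed.

Lemma ip_single i b u : ell2_ip u (single i b) = star (u i) ** b.
Proof.
apply: ell2_ipE; apply/cvg_nrP => e e0; exists [fset i]%fset => // F /=.
rewrite fsub1set => iF; rewrite /gram_net /gram (big_fsetD1 _ iF)/= eqxx big1_seq ?addr0.
  by rewrite subrr nr0.
by move=> j /=; rewrite !inE => /andP[/negPf -> _]; rewrite cmulr0.
Qed.

End Ell2Module.

Lemma cmul_inj (R : realType) (D : cstarType R) (a b : D) :
  (forall x, star a ** x = star b ** x) -> a = b.
Proof.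
move=> h; apply/eqP; rewrite -subr_eq0; apply/eqP/starM_eq0.
by rewrite starB cmulBl h subrr.
Qed.

(** * Weighted translation operators *)

Section WeightedTranslations.
Variables (R : realType) (D : cstarType R) (G : groupType).
Local Notation X := (ell2_module D G).
Local Notation U := (adj (regular_module D)).
Implicit Types (x y : adj X) (m n : G -> U) (g h s : G).

(** The matrix of x has its nonzero entries m s at the positions (g s, s). *)
Definition translation x g m : Prop := forall (u : ell2 D G) s,
  (x u : ell2 D G) (g * s)%g = m s (u s).

Lemma translation_eq x y g m : translation x g m -> translation y g m -> x = y.
Proof.
move=> hx hy; apply: adj_ext => u; apply: ell2_ext => s.
by rewrite -(mulVKg g s) hx hy.
Qed.

Lemma translationM x y g h m n : translation x g m -> translation y h n ->
  translation (x ** y) (g * h)%g (fun s => m (h * s)%g ** n s).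
Proof. by move=> hx hy u s; rewrite -mulgA; rewrite [LHS]hx hy. Qed.

(** The weights of the adjoint are found by testing against families with a
    single nonzero coordinate. *)
Lemma translation_star x g m : translation x g m ->
  translation (star x) g^-1%g (fun s => star (m (g^-1 * s)%g)).
Proof.
move=> hx u s; apply: cmul_inj => b.
transitivity (ell2_ip u (x (single (g^-1 * s)%g b))).
  by rewrite -ip_single; exact: (@ip_adjV _ _ X).
have -> : x (single (g^-1 * s)%g b) = single s (m (g^-1 * s)%g b).
  apply: ell2_ext => t; rewrite -[t in LHS](mulVKg g) hx !singleE.
  rewrite -(inj_eq (mulgI g^-1%g) t s).
  by have [->//|_] := eqVneq; rewrite adj_fun0.
rewrite ip_single; symmetry; exact: (@ip_adjV _ _ (regular_module D)).
Qed.

Lemma translation_add x y g m n : translation x g m -> translation y g n ->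
  translation (x + y) g (fun s => m s + n s).
Proof. by move=> hx hy u s; rewrite [LHS]ell2_addE hx hy. Qed.

Lemma translation_scale a x g m : translation x g m ->
  translation (a *: x) g (fun s => a *: m s).
Proof. by move=> hx u s; rewrite [LHS]ell2_scaleE hx. Qed.

Lemma translation0 g : translation 0 g (fun=> 0).
Proof. by []. Qed.

Lemma nr_translation_weight x g m s : translation x g m -> nr (m s) <= nr x.
Proof.
move=> hx; apply: nr_adj_le => [|b]; first exact: nr_ge0.
have := hx (single s b) s; rewrite singleE eqxx => <-.
apply: (le_trans (nr_coord _ _)).
apply: (le_trans (nr_adj_app x (single s b : X))).
by rewrite ler_wpM2l ?nr_ge0//; exact: nr_single.
Qed.

Let tr g (F : {fset G}) : {fset G} := [fset (g^-1 * s)%g | s in F]%fset.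

Let big_tr g F (f : G -> D) : \sum_(s <- tr g F) f s = \sum_(s <- F) f (g^-1 * s)%g.
Proof. by rewrite /tr big_imfset//= => s t _ _ /mulgI. Qed.

Let semi_translate g m (K : R) (u : G -> D) (F : {fset G}) : (forall s, nr (m s) <= K) ->
  semi F (fun s => m (g^-1 * s)%g (u (g^-1 * s)%g) : D) <= K * semi (tr g F) u.
Proof.
move=> mK; have K0 : 0 <= K by rewrite (le_trans _ (mK 1%g)) ?nr_ge0.
rewrite -(@ler_pXn2r _ 2)// ?nnegrE ?mulr_ge0 ?semi_ge0//.
rewrite exprMn !sqr_semi /gram big_tr.
have <- : nr ((K ^+ 2)%:C *: (\sum_(s <- F) star (u (g^-1 * s)%g) ** u (g^-1 * s)%g)) =
   K ^+ 2 * nr (\sum_(s <- F) star (u (g^-1 * s)%g) ** u (g^-1 * s)%g).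
  by rewrite nrZr ger0_norm ?sqr_ge0.
apply: dpos_nr_mono; first by apply: dpos_sum => s _; exact: dpos_starM.
rewrite scaler_sumr -sumrB; apply: dpos_sum => s _; exact: dpos_adj.
Qed.

Let translate_summable g m (K : R) : (forall s, nr (m s) <= K) ->
  forall u : ell2 D G,
  square_summable (fun s => m (g^-1 * s)%g (u (g^-1 * s)%g) : D).
Proof.
move=> mK u e e0; have K0 : 0 <= K by rewrite (le_trans _ (mK 1%g)) ?nr_ge0.
have K1 : 0 < K + 1 by rewrite ltr_wpDl.
have d0 : 0 < e / (K + 1) by rewrite divr_gt0.
have [F0 h0] := ell2P u d0; exists (tr g^-1%g F0) => F dF.
rewrite (le_trans (semi_translate _ _ _ mK))//.
have h : semi (tr g F) u <= e / (K + 1).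
  apply: h0; apply/fdisjointP => s sF0; apply/imfsetP => -[t /= tF st].
  move/fdisjointP : dF => /(_ t); rewrite tF => /(_ _)/negP; apply => //.
  by apply/imfsetP; exists s => //=; rewrite invgK st mulVKg.
rewrite (@le_trans _ _ (K * (e / (K + 1))))//; first by rewrite ler_wpM2l.
by rewrite mulrCA ler_piMr ?(ltW e0)// ler_pdivrMr// mul1r lerDl ler01.
Qed.

(** Each x* m* m x is at most K^2 x* x, so square-summability is preserved; the
    adjoint is the translation by the inverse with the adjoint weights. *)
Lemma translation_exists g m (K : R) : (forall s, nr (m s) <= K) ->
  exists x, translation x g m.
Proof.
move=> mK; have K0 : 0 <= K by rewrite (le_trans _ (mK 1%g)) ?nr_ge0.
pose m' s := star (m (g^-1 * s)%g).
have m'K s : nr (m' s) <= K by rewrite nr_star; exact: mK.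
pose f u := mk_ell2 (translate_summable g mK u).
pose f' u := mk_ell2 (translate_summable g^-1%g m'K u).
have hf : @adjointable _ _ X f.
  exists f'; split; last first.
    exists K => u; split; apply: ell2_nr_le => F.
      rewrite (le_trans (semi_translate _ _ _ mK))// ler_wpM2l//.
      exact: semi_le_ell2.
    rewrite (le_trans (semi_translate _ _ _ m'K))// ler_wpM2l//.
    exact: semi_le_ell2.
  move=> u v; apply: ell2_ipE; apply/cvg_nrP => e e0.
  have /cvg_nrP/(_ e e0)[F0 _ h0] := @cvg_ell2_ip _ _ _ u (f' v).
  exists (tr g^-1%g F0) => // F /= F0F.
  have /h0 /= : (F0 `<=` tr g F)%fset.
    apply/fsubsetP => s sF; apply/imfsetP; exists (g * s)%g => /=.
      by apply: (fsubsetP F0F); apply/imfsetP; exists s; rewrite //= invgK.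
    by rewrite mulKg.
  suff -> : gram_net u (f' v) (tr g F) = gram_net (f u) v F by [].
  rewrite /gram_net /gram big_tr; apply: eq_bigr => s _ /=.
  rewrite /m' invgK mulVKg.
  by symmetry; exact: (@ip_star _ _ (regular_module D)).
exists (mk_adj hf) => u s /=.
by rewrite mulKg.
Qed.

End WeightedTranslations.

(** * Cuntz-Krieger relations *)

Section CuntzKrieger.
Variables (R : realType) (E : digraph) (A : cstarType R).
Variables (P : vertex E -> A) (S : edge E -> A).
Hypothesis ck : cuntz_krieger P S.

(** With p = P (source e), q = S e (S e)* and p - q = z* z, the sum of the
    positive elements (q - p q)* (q - p q) and (z q)* (z q) is zero. *)
Lemma ck_source_mul e : P (source e) ** S e = S e.
Proof.
set p := P _; have [sp pp] := ck_projection ck (source e).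
have Se := ck_partial_isometry ck e; pose q := S e ** star (S e).
have sq : star q = q by rewrite starM starK.
have qq : q ** q = q by rewrite /q cmulA Se.
have [z zE] : cstar_le q p := ck2 ck e.
suff /eqP : q - p ** q = 0.
  by rewrite subr_eq0 => /eqP h; rewrite -[in LHS]Se cmulA -/q -h /q Se.
apply: starM_eq0; apply/nr_eq0/eqP; rewrite eq_le nr_ge0 andbT.
rewrite -(nr0 A); apply: dpos_nr_mono; first exact: dpos_starM.
suff -> : 0 - star (q - p ** q) ** (q - p ** q) = star (z ** q) ** (z ** q).
  exact: dpos_starM.
have qpq : q ** p ** q = q + star (z ** q) ** (z ** q).
  have -> : star (z ** q) ** (z ** q) = q ** (star z ** z) ** q.
    by rewrite starM sq !cmulA.
  by rewrite -zE cmulBr cmulBl !qq subrKC.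
rewrite starB starM sq sp cmulBl !cmulBr cmulA qq.
rewrite -[q ** p ** (p ** q)]cmulA [p ** (p ** q)]cmulA pp cmulA.
by rewrite subrr subr0 qpq opprB addrAC subrr !add0r.
Qed.

Lemma ck_mul_range e : S e ** P (Defs.range e) = S e.
Proof. by rewrite -(ck1 ck) cmulA (ck_partial_isometry ck). Qed.

Lemma ck_vertex_mul_edge v e : v <> source e -> P v ** S e = 0.
Proof.
by move=> ve; rewrite -ck_source_mul cmulA (ck_vertex_orthogonal ck ve) cmul0r.
Qed.

Lemma ck_edge_mul_vertex e v : v <> Defs.range e -> S e ** P v = 0.
Proof.
move=> ve; rewrite -ck_mul_range -cmulA (ck_vertex_orthogonal ck) ?cmulr0//.
exact: nesym.
Qed.

Lemma nr_ck_vertex v : nr (P v) <= 1.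
Proof. exact/nr_projection/(ck_projection ck). Qed.

Lemma nr_ck_edge e : nr (S e) <= 1.
Proof.
by rewrite -(@ler_pXn2r _ 2)// ?nnegrE ?nr_ge0// -nr_starM (ck1 ck) expr1n nr_ck_vertex.
Qed.

End CuntzKrieger.

(** * Cuntz-Krieger families of weighted translations *)

Section CuntzKriegerTranslations.
Variables (R : realType) (D : cstarType R) (G : groupType) (F : digraph).
Local Notation X := (ell2_module D G).
Variables (y : vertex F -> adj X) (x : edge F -> adj X).
Variables (p : vertex F -> G -> D) (g : edge F -> G) (m : edge F -> G -> D).
Hypothesis hy : forall v, translation (y v) 1%g (fun s => lmul (p v s)).
Hypothesis hx : forall e, translation (x e) (g e) (fun s => lmul (m e s)).

Let lh := @lmul_hom R D.

Let hxx e : translation (x e ** star (x e)) 1%g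
  (fun s => lmul (m e ((g e)^-1 * s)%g ** star (m e ((g e)^-1 * s)%g))).
Proof.
have := translationM (hx e) (translation_star (hx e)).
rewrite mulgV; congr (translation _ _ _); apply/funext => s.
by rewrite -(hom_star lh) -(homM lh).
Qed.

Let translation_of_eq (z z' : adj X) h (n n' : G -> D) :
  translation z h (fun s => lmul (n s)) -> translation z' h (fun s => lmul (n' s)) ->
  (forall s, n s = n' s) -> z = z'.
Proof. by move=> hz hz' /funext nn; apply: (translation_eq hz); rewrite nn. Qed.

Let translation_sum (s : seq (edge F)) (z : edge F -> adj X) (n : edge F -> G -> D) :
  (forall e, translation (z e) 1%g (fun t => lmul (n e t))) ->
  translation (\sum_(e <- s) z e) 1%g (fun t => lmul (\sum_(e <- s) n e t)).
Proof.
move=> hz; elim: s => [|e s IH].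
  rewrite big_nil (_ : (fun t => _) = (fun=> 0)); first exact: translation0.
  by apply/funext => t; rewrite big_nil (hom0 lh).
rewrite big_cons; have := translation_add (hz e) IH.
congr (translation _ _ _); apply/funext => t.
by rewrite big_cons (homD lh).
Qed.

(** Products and adjoints of weighted translations are computed on the weights,
    so each relation can be checked at each position. *)
Lemma cuntz_krieger_translations :
  (forall v s, projection (p v s)) ->
  (forall v w s, v <> w -> p v s ** p w s = 0) ->
  (forall e s, partial_isometry (m e s)) ->
  (forall e f s t, e <> f -> (g e * s = g f * t)%g ->
    m e s ** star (m e s) ** (m f t ** star (m f t)) = 0) ->
  (forall e s, star (m e s) ** m e s = p (Defs.range e) s) ->
  (forall e s, p (source e) (g e * s)%g ** m e s = m e s) ->
  (forall v s, let out := [set e | source e = v] in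
    out !=set0 -> finite_set out ->
    p v s = \sum_(e \in out)
      m e ((g e)^-1 * s)%g ** star (m e ((g e)^-1 * s)%g)) ->
  cuntz_krieger y x.
Proof.
move=> h1 h2 h3 h4 h5 h6 h7.
have hyM v w : translation (y v ** y w) 1%g (fun s => lmul (p v s ** p w s)).
  have := translationM (hy v) (hy w); rewrite mulg1.
  by congr (translation _ _ _); apply/funext => s; rewrite mul1g (homM lh).
have tr0 h : translation (0 : adj X) h (fun s => lmul (0 : D)).
  by rewrite (hom0 lh); exact: translation0.
split.
- move=> v; split.
    have := translation_star (hy v); rewrite invg1 => hs.
    apply: (translation_eq hs) => u s; rewrite hy mul1g -(hom_star lh).
    by have [-> _] := h1 v s.
  by apply: (translation_of_eq (hyM v v) (hy v)) => s; have [] := h1 v s.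
- by move=> v w vw; apply: (translation_of_eq (hyM v w) (tr0 _)) => s; exact: h2.
- move=> e; have := translationM (hxx e) (hx e); rewrite mul1g => hs.
  apply: (translation_eq hs) => u s; rewrite hx.
  rewrite -(homM lh) mulKg.
  by rewrite (h3 e s).
- move=> e f ef; have := translationM (hxx e) (hxx f); rewrite mulg1 => hs.
  apply: (translation_eq hs) => u s; rewrite -(homM lh) mul1g h4//.
    by rewrite (hom0 lh).
  by rewrite !mulVKg.
- move=> e; have := translationM (translation_star (hx e)) (hx e).
  rewrite mulVg => hs; apply: (translation_eq hs) => u s; rewrite hy.
  by rewrite mulKg -(hom_star lh) -(homM lh) h5.
- move=> e.
  have hz : translation (y (source e) - x e ** star (x e)) 1%g (fun s =>
      lmul (p (source e) s - m e ((g e)^-1 * s)%g ** star (m e ((g e)^-1 * s)%g))).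
    have := translation_add (hy (source e)) (translation_scale (-1) (hxx e)).
    rewrite scaleN1r; congr (translation _ _ _); apply/funext => s.
    by rewrite scaleN1r -(homB lh).
  exists (y (source e) - x e ** star (x e)).
  have := translationM (translation_star hz) hz; rewrite mulg1 invg1 => hs.
  apply: (translation_eq hz) => u s; rewrite hs; congr (_ _ _).
  rewrite !mul1g -(hom_star lh) -(homM lh); congr lmul.
  set q := m e _ ** _; have sq : star q = q by rewrite starM starK.
  have qq : q ** q = q by rewrite /q cmulA h3.
  have [sp pp] := h1 (source e) s.
  have pq : p (source e) s ** q = q.
    by rewrite /q cmulA -{1}[s](mulVKg (g e)) h6.
  have qp : q ** p (source e) s = q by rewrite -sq -{1}sp -starM pq.
  by rewrite starB sp sq cmulBl !cmulBr pp pq qp qq subrr subr0.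
move=> v /= o0 fo; rewrite fsbig_finite//=.
apply: (translation_of_eq (hy v) (translation_sum _ hxx)) => s.
by rewrite (h7 v s)// fsbig_finite.
Qed.

End CuntzKriegerTranslations.

Section Representations.
Variables (R : realType) (E : digraph) (G : groupType) (c : edge E -> G).
Variables (A : cstarType R) (P : vertex E -> A) (S : edge E -> A).
Hypothesis ckA : cuntz_krieger P S.
Variables (B : cstarType R) (Q : vertex (skew_product c) -> B)
  (W : edge (skew_product c) -> B).
Hypothesis ckB : cuntz_krieger Q W.

(** This turns the sums in (CK3) for the skew product into those for E. *)
Lemma skew_out_bij v s : set_bij [set e | source e = v]
  [set x : edge (skew_product c) | source x = (v, s)]
  (fun e => (e, ((c e)^-1 * s)%g)).
Proof.
split=> [e /= <-|e f _ _ [->]//|[e t] /= [ev cs]].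
  by rewrite mulVKg.
by exists e => //; rewrite -cs mulKg.
Qed.

Lemma skew_out_finite v s : finite_set [set e | source e = v] <->
  finite_set [set x : edge (skew_product c) | source x = (v, s)].
Proof.
have [h1 h2 h3] := skew_out_bij v s; split=> [fo|fo].
  exact: sub_finite_set h3 (finite_image _ fo).
apply: sub_finite_set (finite_image (@fst (edge E) G) fo) => e /h1 he.
by exists (e, ((c e)^-1 * s)%g).
Qed.

(** In the multiplier algebra one would take the strict sums of the Q (v, s) and
    of the W (e, s) over s.  Spreading the summands over the rows of a matrix
    indexed by G makes every sum a weighted translation, and keeps each W (e, s)
    accessible as a matrix entry. *)
Lemma amplified_family : exists
    (y : vertex E -> adj (ell2_module B G)) (x : edge E -> adj (ell2_module B G)),
  [/\ cuntz_krieger y x,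
      forall v, translation (y v) 1%g (fun s => lmul (Q (v, s))) &
      forall e, translation (x e) (c e) (fun s => lmul (W (e, s)))].
Proof.
have /choice[y hy] : forall v, exists y : adj (ell2_module B G),
    translation y 1%g (fun s => lmul (Q (v, s))).
  by move=> v; apply: (translation_exists _ (K := 1)) => s;
     rewrite nr_lmul; exact: nr_ck_vertex ckB _.
have /choice[x hx] : forall e, exists x : adj (ell2_module B G),
    translation x (c e) (fun s => lmul (W (e, s))).
  by move=> e; apply: (translation_exists _ (K := 1)) => s;
     rewrite nr_lmul; exact: nr_ck_edge ckB _.
exists y, x; split=> //.
apply: (cuntz_krieger_translations (p := fun v s => Q (v, s))
  (m := fun e s => W (e, s)) hy hx) => /=.
- by move=> v s; exact: ck_projection ckB _.
- by move=> v w s vw; apply: (ck_vertex_orthogonal ckB); case.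
- by move=> e s; exact: ck_partial_isometry ckB _.
- by move=> e f s t ef _; apply: (ck_range_orthogonal ckB); case.
- by move=> e s; rewrite (ck1 ckB).
- by move=> e s; exact: ck_source_mul ckB (e, s).
move=> v s o0 fo; rewrite (ck3 ckB).
- by rewrite (reindex_fsbig _ _ _ _ (skew_out_bij v s)).
- have [e ev] := o0; exists (e, ((c e)^-1 * s)%g).
  by have [h1 _ _] := skew_out_bij v s; exact: h1.
by apply/skew_out_finite.
Qed.

(** The family behind the representation of C*(E x_c G) on A tensored with the
    compact operators of l2(G), which sends Q (v, s) to P v at the position
    (s, s) and W (e, s) to S e at the position (c(e) s, s) *)
Lemma matrix_unit_family : exists
    (y : vertex (skew_product c) -> adj (ell2_module A G))
    (x : edge (skew_product c) -> adj (ell2_module A G)),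
  [/\ cuntz_krieger y x,
      forall v s, translation (y (v, s)) 1%g
        (fun r => lmul (if r == s then P v else 0)) &
      forall e s, translation (x (e, s)) (c e)
        (fun r => lmul (if r == s then S e else 0))].
Proof.
have nr_if (b : bool) (a : A) : nr a <= 1 -> nr (if b then a else 0) <= 1.
  by case: b => //; rewrite nr0.
have /choice[y hy] : forall v : vertex (skew_product c),
    exists y : adj (ell2_module A G),
    translation y 1%g (fun r => lmul (if r == v.2 then P v.1 else 0)).
  move=> v; apply: (translation_exists _ (K := 1)) => s.
  by rewrite nr_lmul nr_if//; exact: nr_ck_vertex ckA _.
have /choice[x hx] : forall e : edge (skew_product c),
    exists x : adj (ell2_module A G),
    translation x (c e.1) (fun r => lmul (if r == e.2 then S e.1 else 0)).
  move=> e; apply: (translation_exists _ (K := 1)) => s.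
  by rewrite nr_lmul nr_if//; exact: nr_ck_edge ckA _.
exists y, x; split=> [|v s|e s]; [|exact: hy (v, s)|exact: hx (e, s)].
apply: (cuntz_krieger_translations hy hx) => /=.
- move=> v s; have [_|_] := eqVneq s v.2; first exact: ck_projection ckA _.
  by split; rewrite ?star0 ?cmul0r.
- move=> [v r] [w t] s /= vw; have [sr|_] := eqVneq s r; last by rewrite cmul0r.
  have [st|_] := eqVneq s t; last by rewrite cmulr0.
  by apply: (ck_vertex_orthogonal ckA) => vw'; apply: vw; rewrite -sr -st vw'.
- move=> e s; have [_|_] := eqVneq s e.2; first exact: ck_partial_isometry ckA _.
  by rewrite /partial_isometry !cmul0r.
- move=> [e r] [f r'] s t /= ef gst.
  have [sr|_] := eqVneq s r; last by rewrite !cmul0r.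
  have [tr|_] := eqVneq t r'; last by rewrite !(cmul0r, cmulr0).
  apply: (ck_range_orthogonal ckA) => ef'; apply: ef; rewrite ef' in gst *.
  by move/mulgI: gst => st; rewrite -sr -tr st.
- move=> [e r] s /=; have [_|_] := eqVneq s r; first by rewrite (ck1 ckA).
  by rewrite cmulr0.
- move=> [e r] s /=; have [->|_] := eqVneq s r; last by rewrite cmulr0.
  by rewrite eqxx (ck_source_mul ckA).
move=> [v r] s /= [[e t] /= [ev ct]] fo.
have fo' : finite_set [set e | source e = v] by apply/skew_out_finite; exact: fo.
rewrite (reindex_fsbig _ _ _ _ (skew_out_bij v r)) /=.
have [->|sr] := eqVneq s r.
  rewrite (ck3 ckA); [|by exists e|exact: fo'].
  by apply: eq_fsbigr => f _; rewrite eqxx.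
rewrite fsbig1// => f _.
by rewrite (inj_eq (mulgI _)) (negPf sr) cmul0r.
Qed.

End Representations.

(** * The regular representation of the tensor product *)

Section RegularRepresentation.
Variables (R : realType) (G : groupType) (A C T : cstarType R).
Variables (u : G -> C) (t : A -> C -> T).
Hypotheses (hC : group_cstar_algebra u) (hT : cstar_tensor t).
Local Notation X := (ell2_module A G).
Local Notation e := (adj_one (regular_module A)).

(** The tensor product of the identity of A and the left regular representation
    of G.  Its diagonal entries play the role of the slice map by the canonical
    trace of C*(G), and separate the degrees in G. *)
Lemma regular_representation : exists rho : T -> adj X, star_hom rho /\
  forall a g, translation (rho (t a (u g))) g (fun=> lmul a).
Proof.
have lh := @lmul_hom R A.
have /choice[diag hd] : forall a, exists x : adj X, translation x 1%g (fun=> lmul a).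
  by move=> a; apply: (translation_exists _ (K := nr a)) => s; rewrite nr_lmul.
have /choice[lam hl] : forall g, exists x : adj X, translation x g (fun=> e).
  move=> g; apply: (translation_exists _ (K := 1)) => s.
  by apply: nr_adj_le => // b; rewrite mul1r.
have lam1 : lam 1%g = adj_one X.
  by apply: (translation_eq (hl 1%g)) => v s; rewrite mul1g.
have [|Lam [hLam LamE]] := group_universal hC (w := lam).
  split=> [x|g h|g].
  - by rewrite lam1; split; [exact: adj1l|exact: adj1r].
  - apply: (translation_eq (hl _)).
    have := translationM (hl g) (hl h).
    by congr (translation _ _ _); apply/funext => s; exact: adj1l.
  have se : star e = e by apply: starP.
  rewrite lam1; split.
    have := translationM (translation_star (hl g)) (hl g); rewrite mulVg => hs.
    by apply: (translation_eq hs) => v s; rewrite mul1g se.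
  have := translationM (hl g) (translation_star (hl g)); rewrite mulgV => hs.
  by apply: (translation_eq hs) => v s; rewrite mul1g se.
have diag_hom : star_hom diag.
  split=> [k a b|a b|a].
  - apply: (translation_eq (hd _)).
    have := translation_add (translation_scale k (hd a)) (hd b).
    by congr (translation _ _ _); apply/funext => s; rewrite (homD lh) (homZ lh).
  - apply: (translation_eq (hd _)).
    have := translationM (hd a) (hd b); rewrite mulg1.
    by congr (translation _ _ _); apply/funext => s; rewrite (homM lh).
  apply: (translation_eq (hd _)).
  have := translation_star (hd a); rewrite invg1.
  by congr (translation _ _ _); apply/funext => s; rewrite (hom_star lh).
have comm a x : diag a ** Lam x = Lam x ** diag a.
  pose D := [set x | forall a, diag a ** Lam x = Lam x ** diag a].
  suff : D = setT by move=> DT; have : D x by [rewrite DT]; exact.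
  apply: (group_generates hC).
    split=> [||k y z Dy Dz b|y z Dy Dz b|y Dy b].
    - apply/closed_nrP => y hy b; apply/eqP; rewrite -subr_eq0.
      apply/eqP/nr_ltP => d d0.
      pose K := 2 * nr (diag b) + 1.
      have K0 : 0 < K by rewrite ltr_wpDl// mulr_ge0// nr_ge0.
      have [z Dz yz] := hy _ (divr_gt0 d0 K0).
      have -> : diag b ** Lam y - Lam y ** diag b =
          diag b ** Lam (y - z) - Lam (y - z) ** diag b.
        by rewrite (homB hLam) cmulBr cmulBl Dz opprB addrA subrK.
      rewrite (le_trans (nrB _ _))//.
      have h1 := nr_cmul (diag b) (Lam (y - z)).
      have h2 := nr_cmul (Lam (y - z)) (diag b).
      have h3 := star_hom_le hLam (y - z).
      move: yz; rewrite ltr_pdivlMr// => yz.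
      by have := nr_ge0 (diag b); rewrite /K in yz; nra.
    - by move=> b; rewrite (hom0 hLam) cmul0r cmulr0.
    - by rewrite (homD hLam) (homZ hLam) cmulDr cmulDl scaler_cmulr scaler_cmull Dy Dz.
    - by rewrite (homM hLam) cmulA Dy -cmulA Dz cmulA.
    apply: (can_inj (@starK R _)).
    by rewrite !starM (hom_star hLam) starK -(hom_star diag_hom) Dy.
  move=> _ [g _ <-] b; rewrite LamE.
  have hs := translationM (hd b) (hl g); have hs' := translationM (hl g) (hd b).
  rewrite mul1g in hs; rewrite mulg1 in hs'.
  by apply: (translation_eq hs) => v s; rewrite hs'.
have [|rho [hrho rhoE]] := tensor_universal hT (w := fun a x => diag a ** Lam x).
  split=> [x k a b|a k x y|a x a' x'|a x].
  - by rewrite (homD diag_hom) (homZ diag_hom) cmulDl scaler_cmull.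
  - by rewrite (homD hLam) (homZ hLam) cmulDr scaler_cmulr.
  - rewrite (homM diag_hom) (homM hLam) -!cmulA; congr (_ ** _).
    by rewrite !cmulA comm.
  by rewrite starM (hom_star diag_hom) (hom_star hLam) -(hom_star diag_hom)
     -(hom_star hLam) comm.
exists rho; split=> // a g; rewrite rhoE LamE.
have := translationM (hd a) (hl g); rewrite mul1g.
by congr (translation _ _ _); apply/funext => s; exact: adj1r.
Qed.

End RegularRepresentation.

(** * Dense spans in generated C*-algebras *)

Section Span.
Variables (R : realType) (A : cstarType R).
Implicit Types (X Y : set A) (a y z : A).

Inductive span Y : A -> Prop :=
| span_zero : span Y 0
| span_add y z : Y y -> span Y z -> span Y (y + z).

Lemma spanD Y y z : span Y y -> span Y z -> span Y (y + z).
Proof.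
move=> sy sz; elim: sy => [|x w Yx _ IH]; first by rewrite add0r.
by rewrite -addrA; exact: span_add.
Qed.

Lemma span_split Y Y1 Y2 z : (forall y, Y y -> Y1 y \/ Y2 y) -> span Y z ->
  exists z1 z2, [/\ span Y1 z1, span Y2 z2 & z = z1 + z2].
Proof.
move=> YY; elim=> [|x w /YY Yx _ [z1 [z2 [s1 s2 ->]]]].
  by exists 0, 0; rewrite addr0; split=> //; exact: span_zero.
case: Yx => Yx; [exists (x + z1), z2|exists z1, (x + z2)]; split => //.
- exact: span_add.
- by rewrite addrA.
- exact: span_add.
by rewrite addrCA.
Qed.

(** The closure of the span of Y is a C*-subalgebra. *)
Lemma span_dense X Y : generates X -> X `<=` Y ->
  (forall (k : R[i]) y, Y y -> Y (k *: y)) ->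
  (forall y z, Y y -> Y z -> Y (y ** z)) ->
  (forall y, Y y -> Y (star y)) ->
  forall a (e : R), 0 < e -> exists2 z, span Y z & nr (a - z) < e.
Proof.
move=> gX XY YZ YM Ys.
have sZ (k : R[i]) y : span Y y -> span Y (k *: y).
  elim=> [|x w Yx _ IH]; first by rewrite scaler0; exact: span_zero.
  by rewrite scalerDr; apply: span_add => //; exact: YZ.
have sM y z : span Y y -> span Y z -> span Y (y ** z).
  move=> sy sz; elim: sy => [|x w Yx _ IH]; first by rewrite cmul0r; exact: span_zero.
  rewrite cmulDl; apply: spanD => //.
  elim: sz => [|x' w' Yx' _ IH']; first by rewrite cmulr0; exact: span_zero.
  by rewrite cmulDr; apply: span_add => //; exact: YM.
have ss y : span Y y -> span Y (star y).
  elim=> [|x w Yx _ IH]; first by rewrite star0; exact: span_zero.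
  by rewrite starD; apply: span_add => //; exact: Ys.
pose D := [set a : A | forall e : R, 0 < e -> exists2 z, span Y z & nr (a - z) < e].
suff DT : D = setT by move=> a; have : D a by rewrite DT.
apply: gX; last first.
  move=> x /XY Yx e e0; exists (x + 0); last by rewrite addr0 subrr nr0.
  by apply: span_add => //; exact: span_zero.
split=> [||k x y Dx Dy e e0|x y Dx Dy e e0|x Dx e e0].
- apply/closed_nrP => x hx e e0; have e2 : 0 < e / 2 by rewrite divr_gt0.
  have [y Dy xy] := hx _ e2; have [z sz yz] := Dy _ e2.
  by exists z => //; rewrite (le_lt_trans (nr_trans y _ _))//; lra.
- by move=> e e0; exists 0; [exact: span_zero|rewrite subrr nr0].
- have [d d0 hd] := linear_approx A k e0.
  have [x' sx xx] := Dx _ d0; have [y' sy yy] := Dy _ d0.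
  by exists (k *: x' + y'); [apply: spanD => //; exact: sZ|exact: hd].
- pose d := Num.min 1 (e / (nr x + nr y + 1)).
  have n0 : 0 < nr x + nr y + 1 by rewrite ltr_wpDl// addr_ge0 ?nr_ge0.
  have d0 : 0 < d by rewrite lt_min ltr01 divr_gt0.
  have [x' sx xx] := Dx _ d0; have [y' sy yy] := Dy _ d0.
  exists (x' ** y'); first exact: sM.
  have d1 : d <= 1 by rewrite ge_min lexx.
  rewrite (lt_le_trans (cmul_approx d1 xx yy))//.
  by rewrite -ler_pdivlMr// ge_min lexx orbT.
have [z sz xz] := Dx _ e0; exists (star z); first exact: ss.
by rewrite -starB nr_star.
Qed.

End Span.

(** * Closed graphs of partial isomorphisms *)

Section IsometricGraph.
Variables (R : realType).

Definition graph_closure (A B : cstarType R) (Gr : A -> B -> Prop) a b : Prop :=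
  forall e : R, 0 < e -> exists a' b',
    [/\ Gr a' b', nr (a - a') < e & nr (b - b') < e].

(** If the graph preserves norms of differences, points of the graph
    approaching a given a have second coordinates forming a Cauchy filter. *)
Lemma graph_closure_total (A B : cstarType R) (Gr : A -> B -> Prop) (a : A) :
  (forall x y x' y', Gr x y -> Gr x' y' -> nr (y - y') = nr (x - x')) ->
  (forall e : R, 0 < e -> exists x y, Gr x y /\ nr (a - x) < e) ->
  exists b, graph_closure Gr a b.
Proof.
move=> iso dense.
pose S (e : R) := [set y : B | exists2 x, Gr x y & nr (a - x) < e].
pose F := filter_from [set e : R | 0 < e] S.
have FF : ProperFilter F.
  apply: filter_from_proper; last first.
    by move=> e /= /dense[x [y [xy ax]]]; exists y, x.
  apply: filter_from_filter; first by exists 1; exact: ltr01.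
  move=> e1 e2 /= e10 e20; exists (Num.min e1 e2); first by rewrite /= lt_min e10.
  by move=> y [x xy]; rewrite lt_min => /andP[h1 h2]; split; exists x.
have Fc : nr_cauchy F.
  move=> e e0; have e2 : 0 < e / 2 by rewrite divr_gt0.
  have [x [y [xy ax]]] := dense _ e2; exists y, (e / 2) => // y' [x' xy' ax'] /=.
  rewrite (iso _ _ _ _ xy xy') (le_lt_trans (nr_trans a _ _))//.
  by rewrite nrBC in ax; lra.
have /cvg_ex[b Fb] : cvg F by apply: cauchy_cvg; exact/cauchy_nrP.
exists b => e e0.
have Fbe : F [set y | nr (b - y) < e] by apply: Fb; apply/nbhs_nrP; exists e.
have FSe : F (S e) by exists e.
have [y [/= by_ [x xy ax]]] := filter_ex (filterI Fbe FSe).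
by exists x, y.
Qed.

Variables (A B : cstarType R) (Gr : A -> B -> Prop) (X : set A) (Y : set B).
Hypothesis graph_linear : forall (k : R[i]) a b a' b',
  Gr a b -> Gr a' b' -> Gr (k *: a + a') (k *: b + b').
Hypothesis graph_mul : forall a b a' b', Gr a b -> Gr a' b' -> Gr (a ** a') (b ** b').
Hypothesis graph_star : forall a b, Gr a b -> Gr (star a) (star b).
Hypothesis graph_isometric : forall a b, Gr a b -> nr b = nr a.
Hypotheses (closedX : closed X) (closedY : closed Y).
Hypothesis graph_sub : forall a b, Gr a b -> X a /\ Y b.
Hypothesis graph_denseX : forall a (e : R), X a -> 0 < e ->
  exists x y, Gr x y /\ nr (a - x) < e.
Hypothesis graph_denseY : forall b (e : R), Y b -> 0 < e ->
  exists x y, Gr x y /\ nr (b - y) < e.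

Let Gc := graph_closure Gr.

Let graphB a b a' b' : Gr a b -> Gr a' b' -> Gr (a - a') (b - b').
Proof.
move=> h h'; rewrite addrC -scaleN1r [b - b']addrC -[- b']scaleN1r.
exact: graph_linear.
Qed.

Let closure_linear (k : R[i]) a b a' b' :
  Gc a b -> Gc a' b' -> Gc (k *: a + a') (k *: b + b').
Proof.
move=> h h' e e0.
have [d1 d10 hd1] := linear_approx A k e0.
have [d2 d20 hd2] := linear_approx B k e0.
have d0 : 0 < Num.min d1 d2 by rewrite lt_min d10.
have [x [y [xy ax bY]]] := h _ d0; have [x' [y' [xy' ax' by']]] := h' _ d0.
move: ax bY ax' by'; rewrite !lt_min => /andP[a1 _] /andP[_ b2] /andP[a1' _] /andP[_ b2'].
exists (k *: x + x'), (k *: y + y'); split; first exact: graph_linear.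
  exact: hd1.
exact: hd2.
Qed.

Let closure_mul a b a' b' : Gc a b -> Gc a' b' -> Gc (a ** a') (b ** b').
Proof.
move=> h h' e e0.
pose N := nr a + nr a' + (nr b + nr b') + 1.
have na := nr_ge0 a; have na' := nr_ge0 a'.
have nb := nr_ge0 b; have nb' := nr_ge0 b'.
have N0 : 0 < N by rewrite /N; lra.
pose d := Num.min 1 (e / N).
have d0 : 0 < d by rewrite lt_min ltr01 divr_gt0.
have d1 : d <= 1 by rewrite ge_min lexx.
have de : d * N <= e by rewrite -ler_pdivlMr// ge_min lexx orbT.
have [x [y [xy ax bY]]] := h _ d0; have [x' [y' [xy' ax' by']]] := h' _ d0.
exists (x ** x'), (y ** y'); split; first exact: graph_mul.
  rewrite (lt_le_trans (cmul_approx d1 ax ax'))// (le_trans _ de)//.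
  by rewrite ler_wpM2l ?(ltW d0)// /N; lra.
rewrite (lt_le_trans (cmul_approx d1 bY by'))// (le_trans _ de)//.
by rewrite ler_wpM2l ?(ltW d0)// /N; lra.
Qed.

Let closure_star a b : Gc a b -> Gc (star a) (star b).
Proof.
move=> h e e0; have [x [y [xy ax bY]]] := h _ e0.
by exists (star x), (star y); rewrite -!starB !nr_star; split => //; exact: graph_star.
Qed.

Let closure_isometric a b : Gc a b -> nr b = nr a.
Proof.
move=> h; apply/eqP; rewrite eq_le; apply/andP; split;
  apply/ler_addgt0Pr => e e0; have e2 : 0 < e / 2 by rewrite divr_gt0.
  have [x [y [/graph_isometric xy ax bY]]] := h _ e2.
  have := ler_nrB b y; have := ler_nrB x a; rewrite nrBC in ax; lra.
have [x [y [/graph_isometric xy ax bY]]] := h _ e2.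
have := ler_nrB y b; have := ler_nrB a x; rewrite nrBC in bY; lra.
Qed.

Let closureB a b a' b' : Gc a b -> Gc a' b' -> Gc (a - a') (b - b').
Proof.
move=> h h'; rewrite addrC -scaleN1r [b - b']addrC -[- b']scaleN1r.
exact: closure_linear.
Qed.

Let closure_unique a b b' : Gc a b -> Gc a b' -> b = b'.
Proof.
move=> h h'; apply/eqP; rewrite -subr_eq0; apply/eqP/nr_eq0.
by rewrite (closure_isometric (closureB h h')) subrr nr0.
Qed.

(** The closure of the graph is the graph of a *-isomorphism. *)
Theorem isometric_graph_isomorphic : star_isomorphic X Y.
Proof.
have iso x y x' y' : Gr x y -> Gr x' y' -> nr (y - y') = nr (x - x').
  by move=> h h'; exact/graph_isometric/graphB.
have total a : exists b, X a -> Gc a b.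
  have [Xa|nXa] := pselect (X a); last by exists 0.
  have [b ab] := graph_closure_total iso (fun e => graph_denseX Xa (e := e)).
  by exists b.
have onto b : Y b -> exists a, Gc a b.
  move=> Yb; have [||a ab] := @graph_closure_total B A (fun y x => Gr x y) b.
  - by move=> x y x' y' h h'; rewrite (iso _ _ _ _ h h').
  - move=> e e0; have [x [y [xy bY]]] := graph_denseY Yb e0; by exists y, x.
  by exists a => e /ab[y [x [xy h1 h2]]]; exists x, y.
have GcX a b : Gc a b -> X a.
  move=> h; move/closed_nrP : closedX; apply => e /h[x [y [xy ax _]]].
  by exists x => //; have [] := graph_sub xy.
have GcY a b : Gc a b -> Y b.
  move=> h; move/closed_nrP : closedY; apply => e /h[x [y [xy _ bY]]].
  by exists y => //; have [] := graph_sub xy.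
have [f fP] := choice total.
have fE a b : Gc a b -> f a = b by move=> h; apply: closure_unique (fP _ (GcX _ _ h)) h.
exists f; split.
- split=> [a Xa|a a' /set_mem Xa /set_mem Xa' faa|b /onto[a ab]].
  + exact: GcY (fP a Xa).
  + apply/eqP; rewrite -subr_eq0; apply/eqP/nr_eq0.
    rewrite -(closure_isometric (closureB (fP _ Xa) (fP _ Xa'))).
    by rewrite faa subrr nr0.
  by exists a; [exact: GcX ab|exact: fE].
- by move=> k x y Xx Xy; apply: fE; apply: closure_linear; exact: fP.
- by move=> x y Xx Xy; apply: fE; apply: closure_mul; exact: fP.
by move=> x Xx; apply: fE; apply: closure_star; exact: fP.
Qed.

End IsometricGraph.

(** * Strict sums of orthogonal projections *)

Section ProjectionSums.
Variables (R : realType) (B : cstarType R) (V : choiceType) (q : V -> B).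
Hypothesis q_proj : forall v, projection (q v).
Hypothesis q_orth : forall v w, v <> w -> q v ** q w = 0.
Implicit Types (X : set V) (F : {fset V}) (b c : B).

Definition psum X F : B := \sum_(v <- F | v \in X) q v.

Lemma star_psum X F : star (psum X F) = psum X F.
Proof. by rewrite star_sum; apply: eq_bigr => v _; have [] := q_proj v. Qed.

Lemma psum_mul X F v :
  psum X F ** q v = if (v \in F) && (v \in X) then q v else 0.
Proof.
rewrite /psum cmul_suml; case: ifPn => [/andP[vF vX]|nv].
  rewrite big_mkcond (big_fsetD1 _ vF)/= vX big1_seq ?addr0 => [|w].
    by have [] := q_proj v.
  rewrite !inE => /andP[_ /andP[/eqP wv _]].
  by case: ifP => // _; exact: q_orth.
rewrite big_seq_cond big1// => w /andP[wF wX].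
by apply: q_orth => wv; rewrite -wv wF wX in nv.
Qed.

Lemma mul_psum X F v :
  q v ** psum X F = if (v \in F) && (v \in X) then q v else 0.
Proof.
apply: (can_inj (@starK R B)); have [sq _] := q_proj v.
rewrite starM star_psum sq psum_mul.
by case: ifP => _; rewrite ?sq ?star0.
Qed.

Lemma psum_proj X F : projection (psum X F).
Proof.
split; first exact: star_psum.
rewrite {2}/psum cmul_sumr big_seq_cond [RHS]big_seq_cond.
by apply: eq_bigr => v /andP[vF vX]; rewrite psum_mul vF vX.
Qed.

Lemma psum_psumT X F0 F : (F0 `<=` F)%fset ->
  psum X F ** psum setT F0 = psum X F0.
Proof.
move=> F0F; rewrite {2}/psum cmul_sumr [RHS]big_mkcond/=.
rewrite big_seq_cond [RHS]big_seq; rewrite (eq_bigl (mem F0)) => [|v].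
  by apply: eq_bigr => v vF0; rewrite psum_mul (fsubsetP F0F).
by rewrite in_setT andbT.
Qed.

Lemma nr_psum_mul X F b : nr (psum X F ** b) <= nr b.
Proof.
rewrite (le_trans (nr_cmul _ _))// ler_piMl ?nr_ge0//.
exact/nr_projection/psum_proj.
Qed.

Lemma nr_mul_psum X F b : nr (b ** psum X F) <= nr b.
Proof.
rewrite (le_trans (nr_cmul _ _))// ler_piMr ?nr_ge0//.
exact/nr_projection/psum_proj.
Qed.

Section ApproximateIdentity.
Variable gens : set B.
Hypothesis gensB : generates gens.
Hypothesis gens_supp : forall x, gens x ->
  exists v w, q v ** x = x /\ x ** q w = x.

(** A generator x with x = q_v x = x q_w is fixed by all large partial sums, and
    the elements approximated on both sides form a C*-subalgebra. *)
Lemma psum_approx b (e : R) : 0 < e -> exists F0 : {fset V}, forall F,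
  (F0 `<=` F)%fset -> nr (psum setT F ** b - b) < e.
Proof.
pose P b := forall e : R, 0 < e -> exists F0 : {fset V}, forall F,
  (F0 `<=` F)%fset -> nr (psum setT F ** b - b) < e.
suff DT : [set b | P b /\ P (star b)] = setT.
  move=> e0; have [Pb _] : [set b | P b /\ P (star b)] b by rewrite DT.
  exact: Pb.
have Plin (k : R[i]) x y : P x -> P y -> P (k *: x + y).
  move=> Px Py e' e0.
  have [d d0 hd] := linear_approx B k e0.
  have [F1 h1] := Px _ d0; have [F2 h2] := Py _ d0.
  exists (F1 `|` F2)%fset => F; rewrite fsubUset => /andP[/h1 f1 /h2 f2].
  by rewrite cmulDr scaler_cmulr hd.
have Pmul x y : P x -> P (x ** y).
  move=> Px e' e0; have y1 : 0 < nr y + 1 by rewrite ltr_wpDl ?nr_ge0.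
  have [F0 h0] := Px _ (divr_gt0 e0 y1); exists F0 => F /h0.
  rewrite ltr_pdivlMr// => h; rewrite cmulA -cmulBl (le_lt_trans (nr_cmul _ _))//.
  by rewrite (le_lt_trans _ h)// ler_wpM2l ?nr_ge0// lerDl.
have Plim x : (forall e' : R, 0 < e' -> exists2 y, P y & nr (x - y) < e') -> P x.
  move=> hx e' e0; have e3 : 0 < e' / 3 by rewrite divr_gt0.
  have [y Py xy] := hx _ e3; have [F0 h0] := Py _ e3; exists F0 => F /h0 h.
  rewrite (le_lt_trans (nr_trans y _ _))//.
  have := nr_trans (psum setT F ** y) (psum setT F ** x) y.
  rewrite -cmulBr; have := nr_psum_mul setT F (x - y).
  by rewrite [nr (y - x)]nrBC; lra.
have P0 : P 0 by move=> e' e0; exists fset0 => F _; rewrite cmulr0 subrr nr0.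
apply: gensB; last first.
  move=> x /gens_supp[v [w [vx xw]]]; split=> e' e0.
    exists [fset v]%fset => F; rewrite fsub1set => vF.
    by rewrite -vx cmulA psum_mul vF in_setT/= subrr nr0.
  exists [fset w]%fset => F; rewrite fsub1set => wF.
  have -> : star x = q w ** star x by have [sq _] := q_proj w; rewrite -{1}xw starM sq.
  by rewrite cmulA psum_mul wF in_setT/= subrr nr0.
split=> [||k x y [Px Pxs] [Py Pys]|x y [Px Pxs] [Py Pys]|x [Px Pxs]].
- apply/closed_nrP => x hx; split; apply: Plim => e' /hx[y [Py Pys] xy].
    by exists y.
  by exists (star y) => //; rewrite -starB nr_star.
- by split; rewrite ?star0.
- by split; rewrite ?starD ?starZ; exact: Plin.
- by split; rewrite ?starM; exact: Pmul.
by split; rewrite ?starK.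
Qed.

Lemma psum_approx_r b (e : R) : 0 < e -> exists F0 : {fset V}, forall F,
  (F0 `<=` F)%fset -> nr (b ** psum setT F - b) < e.
Proof.
move=> /(psum_approx (star b))[F0 h0]; exists F0 => F /h0.
by rewrite -nr_star starB starM starK star_psum.
Qed.

Lemma cmul_eq0_of_vertices b c : (forall v, b ** q v ** c = 0) -> b ** c = 0.
Proof.
move=> h; apply: nr_ltP => e e0.
have b1 : 0 < nr b + 1 by rewrite ltr_wpDl ?nr_ge0.
have [F0 h0] := psum_approx c (divr_gt0 e0 b1).
have bFc : b ** (psum setT F0 ** c) = 0.
  by rewrite cmul_suml cmul_sumr big1// => v _; rewrite cmulA h.
have -> : b ** c = - (b ** (psum setT F0 ** c - c)).
  by rewrite cmulBr bFc sub0r opprK.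
rewrite nrN (le_trans (nr_cmul _ _))//.
have := h0 _ (fsubset_refl _); rewrite ltr_pdivlMr// => k.
by have := nr_ge0 (psum setT F0 ** c - c); lra.
Qed.

(** For F0 contained in F the partial sums over X differ on b by the partial sum
    over X and F applied to the error of the approximation of b by F0. *)
Lemma psum_cvg X b : exists l : B, (fun F => psum X F ** b) @ summability.totally --> l.
Proof.
suff : cvg ((fun F => psum X F ** b) @ summability.totally) by move/cvg_ex.
apply: cauchy_cvg; apply/cauchy_nrP => e e0.
have [F0 h0] := psum_approx b e0; exists (psum X F0 ** b), F0 => // F /= F0F.
have -> : psum X F0 ** b - psum X F ** b = psum X F ** (psum setT F0 ** b - b).
  by rewrite cmulBr cmulA psum_psumT.
by rewrite (le_lt_trans (nr_psum_mul _ _ _))// h0// fsubset_refl.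
Qed.

Lemma strictly_sums_exists X : exists m, strictly_sums_to q X m.
Proof.
have /choice[L LP] := psum_cvg X.
pose M b := star (L (star b)).
have MP b : (fun F => b ** psum X F) @ summability.totally --> M b.
  apply/cvg_nrP => e e0; have /cvg_nrP/(_ e e0) := LP (star b).
  apply: filterS => F /=.
  by rewrite /M -nr_star starB starM star_psum starK.
have ML a b : M a ** b = a ** L b.
  apply/eqP; rewrite -subr_eq0; apply/eqP/nr_ltP => e e0.
  have n0 : 0 < nr a + nr b + 1 by rewrite ltr_wpDl// addr_ge0 ?nr_ge0.
  have e2 : 0 < e / 2 by rewrite divr_gt0.
  have d0 := divr_gt0 e2 n0.
  have /cvg_nrP/(_ _ d0) h1 := MP a; have /cvg_nrP/(_ _ d0) h2 := LP b.
  have [F /= [k1 k2]] := filter_ex (filterI h1 h2).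
  have -> : M a ** b - a ** L b =
      (M a - a ** psum X F) ** b - a ** (L b - psum X F ** b).
    by rewrite cmulBl cmulBr cmulA opprB addrA subrK.
  move: k1 k2; rewrite !(ltr_pdivlMr _ _ n0) => k1 k2.
  rewrite (le_trans (nrB _ _))//.
  have j1 : nr ((M a - a ** psum X F) ** b) <= e / 2.
    rewrite (le_trans (nr_cmul _ _))// (le_trans _ (ltW k1))//.
    by rewrite ler_wpM2l ?nr_ge0//; have := nr_ge0 a; lra.
  have j2 : nr (a ** (L b - psum X F ** b)) <= e / 2.
    rewrite (le_trans (nr_cmul _ _))// (le_trans _ (ltW k2))// mulrC.
    by rewrite ler_wpM2l ?nr_ge0//; have := nr_ge0 b; lra.
  lra.
by exists (Multiplier ML) => b; split; [exact: LP|exact: MP].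
Qed.

Lemma strict_sumP X : strictly_sums_to q X (strict_sum q X).
Proof.
rewrite /strict_sum; case: pselect => [h|]; first by case: cid.
by move=> /(_ (strictly_sums_exists X)).
Qed.

(** When the terms outside X annihilate b, the partial sums over X act on b as
    the full partial sums, which converge to b. *)
Lemma corner_strict_sum X : corner (strict_sum q X) =
  [set b | forall v, ~ X v -> q v ** b = 0 /\ b ** q v = 0].
Proof.
have sP := strict_sumP X; move: (strict_sum q X) sP => m mP.
have LP b : (fun F => psum X F ** b) @ summability.totally --> mulL m b.
  by have [] := mP b.
have MP b : (fun F => b ** psum X F) @ summability.totally --> mulR m b.
  by have [] := mP b.
have LM b c : mulL m (b ** c) = mulL m b ** c.
  apply: (nr_cvg_unique _ (LP _)); apply/cvg_nrP => e e0.
  have c1 : 0 < nr c + 1 by rewrite ltr_wpDl ?nr_ge0.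
  have /cvg_nrP/(_ _ (divr_gt0 e0 c1)) := LP b; apply: filterS => F /=.
  rewrite ltr_pdivlMr// cmulA -cmulBl => h; rewrite (le_lt_trans (nr_cmul _ _))//.
  by rewrite (le_lt_trans _ h)// ler_wpM2l ?nr_ge0// lerDl.
have L0 v : ~ X v -> mulL m (q v) = 0.
  move=> nX; apply: (nr_cvg_unique _ (LP _)); apply/cvg_nrP => e e0.
  apply: filterE => F /=; rewrite psum_mul (memNset nX) andbF.
  by rewrite subrr nr0.
have R0 v : ~ X v -> mulR m (q v) = 0.
  move=> nX; apply: (nr_cvg_unique _ (MP _)); apply/cvg_nrP => e e0.
  apply: filterE => F /=; rewrite mul_psum (memNset nX) andbF.
  by rewrite subrr nr0.
apply/seteqP; split=> [_ [b _ <-] v nX|b hb] /=.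
  split; first by rewrite -mulRL R0// cmul0r.
  by rewrite -LM mulRL L0// cmulr0 -[in LHS](cmul0r 0) LM cmulr0.
have psumE F : psum X F ** b = psum setT F ** b.
  rewrite /psum !cmul_suml [LHS]big_mkcond [RHS]big_mkcond; apply: eq_bigr => v _.
  rewrite in_setT; case: ifPn => // /negP nX.
  by have [|-> _] := hb v => // Xv; apply: nX; exact: mem_set.
have psumE' F : b ** psum X F = b ** psum setT F.
  rewrite /psum !cmul_sumr [LHS]big_mkcond [RHS]big_mkcond; apply: eq_bigr => v _.
  rewrite in_setT; case: ifPn => // /negP nX.
  by have [|_ ->] := hb v => // Xv; apply: nX; exact: mem_set.
have Lb : mulL m b = b.
  apply: (nr_cvg_unique _ (LP _)); apply/cvg_nrP => e /(psum_approx b)[F0 h0].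
  by exists F0 => // F /= /h0; rewrite psumE nrBC.
have Rb : mulR m b = b.
  apply: (nr_cvg_unique _ (MP _)); apply/cvg_nrP => e /(psum_approx_r b)[F0 h0].
  by exists F0 => // F /= /h0; rewrite psumE' nrBC.
by exists b => //; rewrite Rb Lb.
Qed.

End ApproximateIdentity.
End ProjectionSums.

(** * Homogeneous elements *)

Section Homogeneous.
Variables (R : realType) (E : digraph) (G : groupType) (c : edge E -> G).
Variables (A : cstarType R) (P : vertex E -> A) (S : edge E -> A).
Hypothesis hA : graph_cstar_algebra P S.
Variables (C : cstarType R) (u : G -> C).
Hypothesis hC : group_cstar_algebra u.
Variables (T : cstarType R) (t : A -> C -> T).
Hypothesis hT : cstar_tensor t.
Variable delta : A -> T.
Hypothesis hdelta : labelling_coaction c P S u t delta.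
Variables (B : cstarType R) (Q : vertex (skew_product c) -> B)
  (W : edge (skew_product c) -> B).
Hypothesis hB : graph_cstar_algebra Q W.

Variable phi : A -> adj (ell2_module B G).
Hypothesis phi_hom : star_hom phi.
Hypothesis phi_vertex : forall v,
  translation (phi (P v)) 1%g (fun s => lmul (Q (v, s))).
Hypothesis phi_edge : forall e,
  translation (phi (S e)) (c e) (fun s => lmul (W (e, s))).

Variable psi : B -> adj (ell2_module A G).
Hypothesis psi_hom : star_hom psi.
Hypothesis psi_vertex : forall v s, translation (psi (Q (v, s))) 1%g
  (fun r => lmul (if r == s then P v else 0)).
Hypothesis psi_edge : forall e s, translation (psi (W (e, s))) (c e)
  (fun r => lmul (if r == s then S e else 0)).

Variable rho : T -> adj (ell2_module A G).
Hypothesis rho_hom : star_hom rho.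
Hypothesis rhoE : forall a g, translation (rho (t a (u g))) g (fun=> lmul a).

Let ckA := graph_family hA.
Let ckB := graph_family hB.
Let lhA := @lmul_hom R A.
Let lhB := @lmul_hom R B.
Let dh := coaction_hom hdelta.
Let tb := tensor_bilinear hT.

(** The model is a = S_mu S_nu^* with c(mu) c(nu)^-1 = g, whose entry m s is the
    corresponding product W_mu' W_nu'^* in the skew product, carrying level s
    to level g s.  The relations listed hold for the generators and survive
    products and adjoints, which avoids any computation with paths. *)
Record homogeneous (g : G) (a : A) (m : G -> B) : Prop := {
  homogeneous_delta : delta a = t a (u g);
  homogeneous_phi : translation (phi a) g (fun s => lmul (m s));
  homogeneous_psi : forall s,
    translation (psi (m s)) g (fun r => lmul (if r == s then a else 0));
  homogeneous_range : forall s v r, r <> (g * s)%g -> Q (v, r) ** m s = 0;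
  homogeneous_source : forall s v r, r <> s -> m s ** Q (v, r) = 0 }.

Let tensor_linear a b (k : R[i]) x : t (k *: a + b) x = k *: t a x + t b x.
Proof. exact: (star_bilinear_l tb x k a b). Qed.

Let tensor0 x : t 0 x = 0.
Proof. by have := tensor_linear 0 0 (-1) x; rewrite scaler0 addr0 scaleN1r addNr. Qed.

Lemma homogeneous_vertex v : homogeneous 1%g (P v) (fun s => Q (v, s)).
Proof.
split=> [||s|s w r rs|s w r rs].
- exact: coaction_vertex hdelta v.
- exact: phi_vertex.
- exact: psi_vertex.
- by apply: (ck_vertex_orthogonal ckB) => -[_]; rewrite mul1g in rs.
by apply: (ck_vertex_orthogonal ckB) => -[_ rs']; apply: rs.
Qed.

Lemma homogeneous_edge e : homogeneous (c e) (S e) (fun s => W (e, s)).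
Proof.
split=> [||s|s w r rs|s w r rs].
- exact: coaction_edge hdelta e.
- exact: phi_edge.
- exact: psi_edge.
- by apply: (ck_vertex_mul_edge ckB) => -[_].
by apply: (ck_edge_mul_vertex ckB) => -[_].
Qed.

Lemma homogeneous0 g : homogeneous g 0 (fun=> 0).
Proof.
split=> [||s|s v r _|s v r _].
- by rewrite (hom0 dh) tensor0.
- by rewrite (hom0 phi_hom) (hom0 lhB); exact: translation0.
- rewrite (hom0 psi_hom); have := translation0 (D := A) g.
  by congr (translation _ _ _); apply/funext => r; rewrite if_same (hom0 lhA).
- by rewrite cmulr0.
by rewrite cmul0r.
Qed.

Lemma homogeneous_linear g (k : R[i]) a m b n :
  homogeneous g a m -> homogeneous g b n ->
  homogeneous g (k *: a + b) (fun s => k *: m s + n s).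
Proof.
move=> ha hb; split=> [||s|s v r rs|s v r rs].
- rewrite (homD dh) (homZ dh) (homogeneous_delta ha) (homogeneous_delta hb).
  by rewrite tensor_linear.
- rewrite (homD phi_hom) (homZ phi_hom).
  have := translation_add (translation_scale k (homogeneous_phi ha)) (homogeneous_phi hb).
  by congr (translation _ _ _); apply/funext => s; rewrite (homD lhB) (homZ lhB).
- rewrite (homD psi_hom) (homZ psi_hom).
  have := translation_add (translation_scale k (homogeneous_psi ha s)) (homogeneous_psi hb s).
  congr (translation _ _ _); apply/funext => r; rewrite -(homZ lhA) -(homD lhA).
  by case: ifP => _; rewrite ?scaler0 ?addr0.
- rewrite cmulDr scaler_cmulr (homogeneous_range ha)// (homogeneous_range hb)//.
  by rewrite scaler0 addr0.
rewrite cmulDl scaler_cmull (homogeneous_source ha)// (homogeneous_source hb)//.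
by rewrite scaler0 addr0.
Qed.

Lemma homogeneousZ g (k : R[i]) a m :
  homogeneous g a m -> homogeneous g (k *: a) (fun s => k *: m s).
Proof.
move=> ha; have := homogeneous_linear k ha (homogeneous0 g); rewrite addr0.
by congr homogeneous; apply/funext => s; rewrite addr0.
Qed.

Lemma homogeneousM g h a m b n : homogeneous g a m -> homogeneous h b n ->
  homogeneous (g * h)%g (a ** b) (fun s => m (h * s)%g ** n s).
Proof.
move=> ha hb; split=> [||s|s v r rs|s v r rs].
- rewrite (homM dh) (homogeneous_delta ha) (homogeneous_delta hb).
  by rewrite (star_bilinear_mul tb) (unitary_repM (group_rep hC)).
- rewrite (homM phi_hom).
  have := translationM (homogeneous_phi ha) (homogeneous_phi hb).
  by congr (translation _ _ _); apply/funext => s; rewrite (homM lhB).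
- rewrite (homM psi_hom).
  have := translationM (homogeneous_psi ha (h * s)%g) (homogeneous_psi hb s).
  congr (translation _ _ _); apply/funext => r; rewrite -(homM lhA).
  by rewrite (inj_eq (mulgI h)); case: ifP => _; rewrite ?cmulr0.
- by rewrite cmulA (homogeneous_range ha) ?cmul0r// mulgA.
by rewrite -cmulA (homogeneous_source hb) ?cmulr0.
Qed.

Let star_u g : star (u g) = u g^-1%g.
Proof.
have hu := group_rep hC; have [ug _] := unitary_rep_unitary hu g.
have [_ s1] := unitary_rep1 hu (star (u g)).
have [u1 _] := unitary_rep1 hu (u g^-1%g).
by rewrite -s1 -(mulgV g) (unitary_repM hu) cmulA ug u1.
Qed.

Lemma homogeneous_star g a m : homogeneous g a m ->
  homogeneous g^-1%g (star a) (fun s => star (m (g^-1 * s)%g)).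
Proof.
move=> ha; split=> [||s|s v r rs|s v r rs].
- by rewrite (hom_star dh) (homogeneous_delta ha) (star_bilinear_star tb) star_u.
- rewrite (hom_star phi_hom); have := translation_star (homogeneous_phi ha).
  by congr (translation _ _ _); apply/funext => s; rewrite (hom_star lhB).
- rewrite (hom_star psi_hom).
  have := translation_star (homogeneous_psi ha (g^-1 * s)%g).
  congr (translation _ _ _); apply/funext => r; rewrite -(hom_star lhA).
  by rewrite (inj_eq (mulgI g^-1%g)); case: ifP => _; rewrite ?star0.
- have [sq _] := ck_projection ckB (v, r).
  by rewrite -sq -starM (homogeneous_source ha)// star0.
have [sq _] := ck_projection ckB (v, r).
by rewrite -sq -starM (homogeneous_range ha) ?star0// mulVKg.
Qed.

(** The homomorphisms phi and psi map a and its entries to each other. *)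
Lemma homogeneous_isometric g a m s : homogeneous g a m -> nr (m s) = nr a.
Proof.
move=> ha; apply/eqP; rewrite eq_le; apply/andP; split.
  rewrite -nr_lmul (le_trans (nr_translation_weight s (homogeneous_phi ha)))//.
  exact: star_hom_le.
have := nr_translation_weight s (homogeneous_psi ha s); rewrite eqxx nr_lmul.
by move/le_trans; apply; exact: star_hom_le.
Qed.

Let q_proj v : projection (Q v). Proof. exact: ck_projection ckB v. Qed.
Let q_orth v w : v <> w -> Q v ** Q w = 0.
Proof. exact: ck_vertex_orthogonal ckB v w. Qed.

Let gens_supp x : ([set Q v | v in setT] `|` [set W e | e in setT]) x ->
  exists v w, Q v ** x = x /\ x ** Q w = x.
Proof.
case=> [[v _ <-]|[e _ <-]].
  by exists v, v; have [_] := q_proj v.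
by exists (source e), (Defs.range e); rewrite (ck_source_mul ckB) (ck_mul_range ckB).
Qed.

(** The entries are supported between different levels. *)
Lemma homogeneous_entry_mul_eq0 g h a m b n s s' : homogeneous g a m ->
  homogeneous h b n -> s <> (h * s')%g -> m s ** n s' = 0.
Proof.
move=> ha hb ss; apply: (cmul_eq0_of_vertices q_proj q_orth (graph_generates hB) gens_supp).
move=> [v r]; have [->|/eqP rs] := eqVneq r s.
  by rewrite -cmulA (homogeneous_range hb)// cmulr0.
by rewrite (homogeneous_source ha)// cmul0r.
Qed.

Lemma homogeneous_dense a (e : R) : 0 < e ->
  exists2 z, span [set b | exists g m, homogeneous g b m] z & nr (a - z) < e.
Proof.
apply: (span_dense (graph_generates hA)).
- move=> _ [[v _ <-]|[f _ <-]].
    by exists 1%g, (fun s => Q (v, s)); exact: homogeneous_vertex.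
  by exists (c f), (fun s => W (f, s)); exact: homogeneous_edge.
- move=> k y [g [m hy]]; exists g, (fun s => k *: m s).
  exact: homogeneousZ.
- move=> y z [g [m hy]] [h [n hz]].
  by exists (g * h)%g, (fun s => m (h * s)%g ** n s); exact: homogeneousM.
move=> y [g [m hy]]; exists g^-1%g, (fun s => star (m (g^-1 * s)%g)).
exact: homogeneous_star.
Qed.

Lemma entries_dense b (e : R) : 0 < e ->
  exists2 z, span [set b | exists g a m s, homogeneous g a m /\ b = m s] z &
             nr (b - z) < e.
Proof.
apply: (span_dense (graph_generates hB)).
- move=> _ [[[v s] _ <-]|[[f s] _ <-]].
    by exists 1%g, (P v), (fun s => Q (v, s)), s; split=> //; exact: homogeneous_vertex.
  by exists (c f), (S f), (fun s => W (f, s)), s; split=> //; exact: homogeneous_edge.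
- move=> k _ [g [a [m [s [hy ->]]]]].
  by exists g, (k *: a), (fun s => k *: m s), s; split => //; exact: homogeneousZ.
- move=> _ _ [g [a [m [s [ha ->]]]]] [h [a' [n [s' [hb ->]]]]].
  have [->|/eqP ss] := eqVneq s (h * s')%g.
    exists (g * h)%g, (a ** a'), (fun s => m (h * s)%g ** n s), s'.
    by split=> //; exact: homogeneousM.
  exists 1%g, 0, (fun=> 0), 1%g; split; first exact: homogeneous0.
  exact: homogeneous_entry_mul_eq0 ha hb ss.
move=> _ [g [a [m [s [ha ->]]]]].
exists g^-1%g, (star a), (fun s => star (m (g^-1 * s)%g)), (g * s)%g.
by rewrite mulKg; split=> //; exact: homogeneous_star.
Qed.

(** Degree 1 preserves every level, so these pairs multiply entrywise; the closure
    of this graph is the graph of the isomorphism. *)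
Definition entry_graph a b : Prop := exists m, homogeneous 1%g a m /\ b = m 1%g.

Let span_entry_graph z : span [set a | exists b, entry_graph a b] z ->
  exists b, entry_graph z b.
Proof.
elim=> [|x w [b [m [hx _]]] _ [b' [n [hw _]]]].
  by exists 0, (fun=> 0); split=> //; exact: homogeneous0.
exists (m 1%g + n 1%g), (fun s => m s + n s); split=> //.
have := homogeneous_linear 1 hx hw; rewrite scale1r.
by congr homogeneous; apply/funext => s; rewrite scale1r.
Qed.

Let span_entry_graph_r z : span [set b | exists a, entry_graph a b] z ->
  exists a, entry_graph a z.
Proof.
elim=> [|_ w [a [m [hx ->]]] _ [a' [n [hw ->]]]].
  by exists 0, (fun=> 0); split=> //; exact: homogeneous0.
exists (a + a'), (fun s => m s + n s); split=> //.
have := homogeneous_linear 1 hx hw; rewrite scale1r.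
by congr homogeneous; apply/funext => s; rewrite scale1r.
Qed.

(** For a fixed point a, the regular representation maps delta a to the
    diagonal operator a; the entry at (1, 1) of the image of delta z only
    sees the part of z of degree 1. *)
Lemma fixed_points_dense a (e : R) : fixed_points u t delta a -> 0 < e ->
  exists x y, entry_graph x y /\ nr (a - x) < e.
Proof.
move=> fa e0; have e2 : 0 < e / 2 by rewrite divr_gt0.
have [z sz az] := homogeneous_dense a e2.
have [|z1 [z2 [s1 s2 zE]]] := @span_split _ _ _ [set a | exists b, entry_graph a b]
    [set a | exists g m, g <> 1%g /\ homogeneous g a m] _ _ sz.
  move=> b [g [m hb]]; have [g1|/eqP g1] := eqVneq g 1%g.
    by left; exists (m 1%g), m; rewrite -g1.
  by right; exists g, m.
have [b ab] := span_entry_graph s1; exists z1, b; split=> //.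
rewrite (@le_lt_trans _ _ (e / 2))//; last lra.
rewrite -nr_lmul; apply: nr_adj_le => [|x]; first exact: ltW.
have th : star_hom (rho \o delta) by exact: star_hom_comp.
pose ent a : A := (rho (delta a) (single 1%g x) : ell2 A G) 1%g.
have entB a1 a2 : ent (a1 - a2) = ent a1 - ent a2.
  by rewrite /ent; have /= -> := homB th a1 a2.
have entD a1 a2 : ent (a1 + a2) = ent a1 + ent a2.
  by rewrite /ent; have /= -> := homD th a1 a2.
have ent_fixed a1 : delta a1 = t a1 (u 1%g) -> ent a1 = a1 ** x.
  move=> d1; rewrite /ent d1; have := rhoE a1 1%g (single 1%g x) 1%g.
  by rewrite mulg1 => ->; rewrite singleE eqxx.
have ent0 : ent z2 = 0.
  elim: s2 => [|y w [g [m [g1 hy]]] _ IH].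
    by rewrite /ent (hom0 dh) (hom0 rho_hom).
  rewrite entD IH addr0 /ent (homogeneous_delta hy).
  have := rhoE y g (single 1%g x) g^-1%g; rewrite mulgV => ->.
  rewrite singleE; case: eqP => [gV|_]; last by rewrite adj_fun0.
  by case: g1; rewrite -[g]invgK gV invg1.
have -> : lmul (a - z1) x = ent (a - z).
  have [m [hz1 _]] := ab.
  rewrite entB zE entD ent0 addr0 ent_fixed// ent_fixed ?(homogeneous_delta hz1)//.
  by rewrite -cmulBl.
apply: (le_trans (nr_coord _ _)).
apply: (le_trans (nr_adj_app (rho (delta (a - z)))
  (single 1%g x : ell2_module A G))).
rewrite ler_pM ?nr_ge0//; last exact: nr_single.
exact: le_trans (star_hom_le th (a - z)) (ltW az).
Qed.

Let K : set B :=
  [set b | forall v, ~ ([set: vertex E] `*` [set 1%g]) v ->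
             Q v ** b = 0 /\ b ** Q v = 0].

Let one_support (v : vertex E) (r : G) :
  ~ ([set: vertex E] `*` [set 1%g]) (v, r) <-> r <> 1%g.
Proof. by split=> [h r1|r1 [_]]; [apply: h; split|]. Qed.

Let entry_in_K a b : entry_graph a b -> K b.
Proof.
move=> [m [ha ->]] [v r] /one_support r1; split.
  by apply: (homogeneous_range ha); rewrite mulg1.
exact: (homogeneous_source ha).
Qed.

(** An approximation of b by entries splits into entries from level 1 to level 1
    and entries leaving or reaching another level.  The partial sums over the
    level 1 annihilate the latter and fix the rest up to a small error. *)
Lemma corner_dense b (e : R) : K b -> 0 < e ->
  exists x y, entry_graph x y /\ nr (b - y) < e.
Proof.
move=> Kb e0; have e3 : 0 < e / 3 by rewrite divr_gt0.
have [z sz bz] := entries_dense b e3.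
pose X := [set: vertex E] `*` [set 1%g : G].
have [|z1 [z2 [s1 s2 zE]]] := @span_split _ _ _ [set b | exists a, entry_graph a b]
    [set b | (forall v, X v -> Q v ** b = 0) \/ (forall v, X v -> b ** Q v = 0)] _ _ sz.
  move=> _ [g [a [m [s [ha ->]]]]].
  have [gs1|/eqP gs1] := eqVneq (g * s)%g 1%g; last first.
    right; left => -[v r] [_ /= ->]; apply: (homogeneous_range ha).
    exact: nesym.
  have [s1|/eqP s1] := eqVneq s 1%g; last first.
    right; right => -[v r] [_ /= ->]; apply: (homogeneous_source ha).
    exact: nesym.
  left; exists a, m; rewrite s1; split=> //.
  by rewrite s1 mulg1 in gs1; rewrite -gs1.
have [a az1] := span_entry_graph_r s1; exists a, z1; split => //.
pose y := b - z1.
have Ky : K y.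
  move=> v nX; have [b1 b2] := Kb v nX; have [c1 c2] := entry_in_K az1 nX.
  by rewrite /y cmulBl cmulBr b1 b2 c1 c2 subrr.
have kill F : psum Q X F ** z2 ** psum Q X F = 0.
  elim: s2 => [|x w hx _ IH]; first by rewrite cmulr0 cmul0r.
  rewrite cmulDr cmulDl IH addr0; case: hx => hx.
    rewrite [psum _ _ _ ** x]cmul_suml big1 ?cmul0r// => v /set_mem; exact: hx.
  rewrite -cmulA [x ** _]cmul_sumr big1 ?cmulr0// => v /set_mem; exact: hx.
have yE F : psum Q X F ** y ** psum Q X F = psum Q X F ** (b - z) ** psum Q X F.
  by rewrite zE opprD addrA -/y [in RHS]cmulBr [in RHS]cmulBl kill subr0.
have yl F : psum Q X F ** y = psum Q setT F ** y.
  rewrite /psum !cmul_suml [LHS]big_mkcond [RHS]big_mkcond; apply: eq_bigr => v _.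
  rewrite in_setT; case: ifPn => // /negP nX.
  by have [|-> _] := Ky v => // Xv; apply: nX; exact: mem_set.
have yr F : y ** psum Q X F = y ** psum Q setT F.
  rewrite /psum !cmul_sumr [LHS]big_mkcond [RHS]big_mkcond; apply: eq_bigr => v _.
  rewrite in_setT; case: ifPn => // /negP nX.
  by have [|_ ->] := Ky v => // Xv; apply: nX; exact: mem_set.
have gB := graph_generates hB.
have [F1 h1] := psum_approx q_proj q_orth gB gens_supp y e3.
have [F2 h2] := psum_approx_r q_proj q_orth gB gens_supp y e3.
pose F := (F1 `|` F2)%fset.
have := h1 F (fsubsetUl _ _); have := h2 F (fsubsetUr _ _).
rewrite -yl -yr => k2 k1.
have : nr (psum Q X F ** y ** psum Q X F) < e / 3.
  rewrite yE (le_lt_trans (nr_mul_psum q_proj q_orth _ _ _))//.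
  by rewrite (le_lt_trans (nr_psum_mul q_proj q_orth _ _ _)).
have := nr_psum_mul q_proj q_orth X F (y ** psum Q X F - y).
rewrite cmulBr cmulA.
have := ler_nrB y (psum Q X F ** y); have := ler_nrB (psum Q X F ** y) (psum Q X F ** y ** psum Q X F).
rewrite [nr (y - _)]nrBC [nr (psum Q X F ** y - _)]nrBC; lra.
Qed.

Lemma fixed_points_closed : closed (fixed_points u t delta).
Proof.
have hu := unitary_rep1 (group_rep hC).
have su1 : star (u 1%g) = u 1%g by rewrite star_u invg1.
have th : star_hom (fun a => t a (u 1%g)).
  split=> [k a b|a b|a]; first exact: tensor_linear.
  - by rewrite (star_bilinear_mul tb); have [-> _] := hu (u 1%g).
  by rewrite (star_bilinear_star tb) su1.
apply/closed_nrP => x hx; apply/eqP; rewrite -subr_eq0; apply/eqP/nr_ltP => e e0.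
have [y fy xy] := hx _ (divr_gt0 e0 (ltr0Sn _ 1)).
rewrite (le_trans (nr_trans (delta y) _ _))// {2}fy.
have := star_hom_le_sub dh x y; have := star_hom_le_sub th y x => /=.
by rewrite [nr (y - x)]nrBC; lra.
Qed.

Let K_closed : closed K.
Proof.
apply/closed_nrP => x hx v nX.
have nQ : nr (Q v) <= 1 by exact: nr_ck_vertex ckB v.
split; apply: nr_ltP => e /hx[y Ky xy]; have [y1 y2] := Ky v nX.
  rewrite -[Q v ** x]subr0 -y1 -cmulBr (le_trans (nr_cmul _ _))//.
  by rewrite (le_trans _ (ltW xy))// ler_piMl ?nr_ge0.
rewrite -[x ** Q v]subr0 -y2 -cmulBl (le_trans (nr_cmul _ _))//.
by rewrite (le_trans _ (ltW xy))// ler_piMr ?nr_ge0.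
Qed.

Lemma fixed_points_isomorphic_corner : star_isomorphic (fixed_points u t delta)
  (corner (strict_sum Q ([set: vertex E] `*` [set 1%g]))).
Proof.
rewrite (corner_strict_sum q_proj q_orth (graph_generates hB) gens_supp).
apply: (@isometric_graph_isomorphic _ _ _ entry_graph).
- move=> k a b a' b' [m [ha ->]] [n [hb ->]].
  by exists (fun s => k *: m s + n s); split=> //; exact: homogeneous_linear.
- move=> a b a' b' [m [ha ->]] [n [hb ->]].
  exists (fun s => m (1 * s)%g ** n s); rewrite mulg1; split=> //.
  by have := homogeneousM ha hb; rewrite mulg1.
- move=> a b [m [ha ->]]; exists (fun s => star (m (1^-1 * s)%g)).
  rewrite invg1 mulg1; split=> //.
  by have := homogeneous_star ha; rewrite invg1.
- by move=> a b [m [ha ->]]; exact: homogeneous_isometric ha.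
- exact: fixed_points_closed.
- exact: K_closed.
- move=> a b ab; split; last exact: entry_in_K ab.
  by have [m [ha _]] := ab; exact: (homogeneous_delta ha).
- by move=> a e; exact: fixed_points_dense.
by move=> b e; exact: corner_dense.
Qed.

End Homogeneous.

Theorem theorem4p6 (R : realType) (E : digraph) (G : groupType)
    (c : edge E -> G)
    (A : cstarType R) (P : vertex E -> A) (S : edge E -> A)
    (hA : graph_cstar_algebra P S)
    (C : cstarType R) (u : G -> C) (hC : group_cstar_algebra u)
    (T : cstarType R) (t : A -> C -> T) (hT : cstar_tensor t)
    (delta : A -> T) (hdelta : labelling_coaction c P S u t delta)
    (B : cstarType R) (Q : vertex (skew_product c) -> B)
    (W : edge (skew_product c) -> B) (hB : graph_cstar_algebra Q W) :
  star_isomorphic (fixed_points u t delta)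
    (corner (strict_sum Q ([set: vertex E] `*` [set 1%g]))).
Proof.
have [y [x [ckyx hy hx]]] := amplified_family (graph_family hB).
have [phi [hphi phiP phiS]] := graph_universal hA ckyx.
have [y' [x' [ckyx' hy' hx']]] := matrix_unit_family c (graph_family hA).
have [psi [hpsi psiQ psiW]] := graph_universal hB ckyx'.
have [rho [hrho rhoE]] := regular_representation hC hT.
apply: (fixed_points_isomorphic_corner hA hC hT hdelta hB hphi _ _ hpsi _ _ hrho rhoE).
- by move=> v; rewrite phiP.
- by move=> e; rewrite phiS.
- by move=> v s; rewrite psiQ.
by move=> e s; rewrite psiW.
Qed.
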